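(* There exists a finitely presented non-amenable boundedly acyclic group.
   Context: All groups are discrete. For a group $\Gamma$ and $n\ge 0$, let $C^n_b(\Gamma;\mathbb{R})$ be the space of bounded functions $f\colon\Gamma^{n+1}\to\mathbb{R}$ that are invariant under the diagonal left-translation action of $\Gamma$, with coboundary $(\delta f)(g_0,\dots,g_{n+1})=\sum_{j=0}^{n+1}(-1)^j f(g_0,\dots,\widehat{g_j},\dots,g_{n+1})$. The bounded cohomology $H^n_b(\Gamma;\mathbb{R})$ is the $n$-th cohomology of this complex. A group $\Gamma$ is boundedly acyclic if $H^n_b(\Gamma;\mathbb{R})\cong 0$ for all $n\ge1$. *)

(* Defs.v *)
From HB Require Import structures.
From mathcomp Require Import all_boot all_order all_algebra.
From mathcomp Require Import zify ring.
From mathcomp Require Import boolp classical_sets functions reals.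

Set Implicit Arguments.
Unset Strict Implicit.
Unset Printing Implicit Defensive.

Import Order.TTheory GRing.Theory Num.Theory.

(* [groupType] is the type of abstract, possibly infinite, groups.  Its       *)
(* choice structure is no restriction, as it exists classically on any type.  *)

Section Presentation.
Variable n : nat.

(* The letter (i, true) stands for the i-th generator, (i, false) for its     *)
(* formal inverse.                                                            *)
Definition letter : Type := 'I_n * bool.
Definition word : Type := seq letter.

Definition inv_letter (a : letter) : letter := (a.1, ~~ a.2).
Definition inv_word (w : word) : word := rev (map inv_letter w).

Variable rels : seq word.

(* The congruence on the free monoid of words whose quotient is the free      *)
(* group on n generators modulo the normal closure of [rels].                 *)
Inductive word_cong : word -> word -> Prop :=
| WordRefl w : word_cong w w
| WordSym v w : word_cong v w -> word_cong w v
| WordTrans u v w : word_cong u v -> word_cong v w -> word_cong u w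
| WordCat v v' w w' :
    word_cong v v' -> word_cong w w' -> word_cong (v ++ w) (v' ++ w')
| WordCancel a : word_cong [:: a; inv_letter a] [::]
| WordRel r : r \in rels -> word_cong r [::].

Definition word_congb : rel word := fun v w => `[< word_cong v w >].

Lemma word_congb_equiv : equiv_class_of word_congb.
Proof.
split=> [w|v w|v u w].
- exact/asboolP/WordRefl.
- by apply/asboolP/asboolP; apply: WordSym.
- by move=> /asboolP vu /asboolP uw; apply/asboolP/(WordTrans vu uw).
Qed.

Canonical word_congb_equivRel := EquivRelPack word_congb_equiv.
Canonical word_congb_encModRel := defaultEncModRel word_congb.

Local Open Scope quotient_scope.

Definition presented_group : Type := {eq_quot word_congb}.
HB.instance Definition _ : EqQuotient word word_congb presented_group :=
  EqQuotient.on presented_group.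
HB.instance Definition _ := Choice.on presented_group.

Lemma inv_letterK : involutive inv_letter.
Proof. by case=> i b; rewrite /inv_letter negbK. Qed.

Lemma inv_wordK : involutive inv_word.
Proof.
by move=> w; rewrite /inv_word map_rev revK (mapK inv_letterK).
Qed.

Lemma word_cong_mulV w : word_cong (w ++ inv_word w) [::].
Proof.
elim: w => [|a w IHw]; first exact: WordRefl.
have -> : (a :: w) ++ inv_word (a :: w) =
    [:: a] ++ (w ++ inv_word w) ++ [:: inv_letter a].
  by rewrite /inv_word /= rev_cons -cats1 -catA.
apply: WordTrans (WordCancel a).
apply: (WordCat (WordRefl [:: a])).
exact: (WordCat IHw (WordRefl [:: inv_letter a])).
Qed.

Lemma word_cong_mulVl w : word_cong (inv_word w ++ w) [::].
Proof. by rewrite -{2}[w]inv_wordK; exact: word_cong_mulV. Qed.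

Lemma word_cong_inv v w :
  word_cong v w -> word_cong (inv_word v) (inv_word w).
Proof.
move=> vw; apply: (@WordTrans _ (inv_word v ++ (w ++ inv_word w))).
  rewrite -{1}[inv_word v]cats0; apply: WordCat (WordRefl _) _.
  exact/WordSym/word_cong_mulV.
rewrite catA -[X in word_cong _ X]cat0s; apply: WordCat (WordRefl _).
apply: WordTrans (word_cong_mulVl v).
exact: WordCat (WordRefl _) (WordSym vw).
Qed.

Definition pres_one : presented_group := lift_cst presented_group [::].
Definition pres_mul :=
  lift_op2 presented_group (fun v w : word => v ++ w).
Definition pres_inv := lift_op1 presented_group inv_word.

Lemma pres_eqP v w :
  \pi_presented_group v = \pi_presented_group w <-> word_cong v w.
Proof.
split=> [/eqP|vw]; first by rewrite eqquotE => /asboolP.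
by apply/eqP; rewrite eqquotE; apply/asboolP.
Qed.

Lemma repr_cong (w : word) : word_cong (repr (\pi_presented_group w)) w.
Proof. by apply/pres_eqP; rewrite reprK. Qed.

Canonical pi_pres_one := PiConst pres_one.

Lemma pi_pres_mul :
  {morph \pi_presented_group : v w / v ++ w >-> pres_mul v w}.
Proof.
move=> v w; unlock pres_mul; apply/pres_eqP.
by apply: WordCat; exact/WordSym/repr_cong.
Qed.
Canonical pi_pres_mul_morph := PiMorph2 pi_pres_mul.

Lemma pi_pres_inv :
  {morph \pi_presented_group : w / inv_word w >-> pres_inv w}.
Proof.
move=> w; unlock pres_inv; apply/pres_eqP.
exact/word_cong_inv/WordSym/repr_cong.
Qed.
Canonical pi_pres_inv_morph := PiMorph1 pi_pres_inv.

Lemma pres_mulA : associative pres_mul.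
Proof. by elim/quotW=> u; elim/quotW=> v; elim/quotW=> w; rewrite !piE catA. Qed.

Lemma pres_mul1g : left_id pres_one pres_mul.
Proof. by elim/quotW=> w; rewrite !piE. Qed.

Lemma pres_mulg1 : right_id pres_one pres_mul.
Proof. by elim/quotW=> w; rewrite !piE cats0. Qed.

Lemma pres_mulVg : left_inverse pres_one pres_inv pres_mul.
Proof.
by elim/quotW=> w; rewrite !piE; apply/pres_eqP/word_cong_mulVl.
Qed.

Lemma pres_mulgV : right_inverse pres_one pres_inv pres_mul.
Proof.
by elim/quotW=> w; rewrite !piE; apply/pres_eqP/word_cong_mulV.
Qed.

HB.instance Definition _ := isGroup.Build presented_group
  pres_mulA pres_mul1g pres_mulg1 pres_mulVg pres_mulgV.

End Presentation.

Definition finitely_presented (G : groupType) : Prop :=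
  exists (n : nat) (rels : seq (word n))
         (f : {multiplicative G -> presented_group rels}), bijective f.

Local Open Scope ring_scope.

Definition bounded_real (R : realType) (T : Type) (f : T -> R) : Prop :=
  exists M : R, forall x, `|f x| <= M.

(* Existence of a left-invariant mean on the bounded functions; [m] is only   *)
(* constrained on these.                                                      *)
Definition amenable (R : realType) (G : groupType) : Prop :=
  exists m : (G -> R) -> R,
    [/\ forall (a : R) (f h : G -> R), bounded_real f -> bounded_real h ->
          m (fun x => a * f x + h x) = a * m f + m h,
        forall f : G -> R, bounded_real f -> (forall x, 0 <= f x) -> 0 <= m f,
        m (fun=> 1) = 1
      & forall (g : G) (f : G -> R), bounded_real f ->
          m (fun x => f (g * x)%g) = m f].

Section BoundedCohomology.
Variables (R : realType) (G : groupType).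

Definition gtuple (n : nat) : Type := {ffun 'I_n.+1 -> G}.

Definition diag_act n (g : G) (t : gtuple n) : gtuple n :=
  [ffun i => (g * t i)%g].

(* (g_0, .., g_{n+1}) with g_j omitted. *)
Definition face n (j : 'I_n.+2) (t : gtuple n.+1) : gtuple n :=
  [ffun i => t (lift j i)].

Definition bounded_invariant n (f : gtuple n -> R^o) : Prop :=
  bounded_real f /\ forall (g : G) t, f (diag_act g t) = f t.

Definition bcochain_pred n : {pred gtuple n -> R^o} :=
  fun f => `[< bounded_invariant f >].
Arguments bcochain_pred : clear implicits.

Lemma bcochain_submod_closed n : submod_closed (bcochain_pred n).
Proof.
split=> [|a f h /asboolP[[M fM] fI] /asboolP[[N hN] hI]]; apply/asboolP.
  by split=> //; exists 0 => t; rewrite normr0.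
split=> [|g t]; last by rewrite !fctE fI hI.
exists (`|a| * M + N) => t; rewrite (le_trans (ler_normD _ _)) // lerD //.
by rewrite normrM ler_wpM2l.
Qed.

HB.instance Definition _ n := GRing.isSubmodClosed.Build R (gtuple n -> R^o)
  (bcochain_pred n) (bcochain_submod_closed n).

(* C^n_b(G; R) *)
Record bcochain n := BCochain {
  bcochain_fun :> gtuple n -> R^o;
  bcochain_funP : bcochain_fun \in bcochain_pred n }.

HB.instance Definition _ n := [isSub for @bcochain_fun n].
HB.instance Definition _ n := [Choice of bcochain n by <:].
HB.instance Definition _ n := [SubChoice_isSubLmodule of bcochain n by <:].

Definition delta_fun n (f : gtuple n -> R^o) (t : gtuple n.+1) : R^o :=
  \sum_(j < n.+2) (-1) ^+ j * f (face j t).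

Lemma delta_fun_bcochain n (f : bcochain n) :
  delta_fun f \in bcochain_pred n.+1.
Proof.
have /asboolP[[M fM] fI] := bcochain_funP f; apply/asboolP; split.
  exists (\sum_(j < n.+2) M) => t; rewrite (le_trans (ler_norm_sum _ _ _)) //.
  by apply: ler_sum => j _; rewrite normrM normrX normrN1 expr1n mul1r.
move=> g t; apply: eq_bigr => j _; congr (_ * _).
by rewrite -(fI g (face j t)); congr (f _); apply/ffunP=> i; rewrite !ffunE.
Qed.

Definition delta n (f : bcochain n) : bcochain n.+1 :=
  BCochain (delta_fun_bcochain f).

Lemma delta_is_linear n : linear (@delta n).
Proof.
move=> a f h; apply/val_inj/funext => t /=.
rewrite -[RHS]/(a * delta_fun f t + delta_fun h t) /delta_fun.
rewrite mulr_sumr -big_split; apply: eq_bigr => j _ /=.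
by rewrite -[X in _ * X = _]/(a * f (face j t) + h (face j t)) mulrDr mulrCA.
Qed.

HB.instance Definition _ n := GRing.isLinear.Build R (bcochain n)
  (bcochain n.+1) *:%R (@delta n) (@delta_is_linear n).

Definition cocycle_pred n : {pred bcochain n} := fun f => delta f == 0.
Arguments cocycle_pred : clear implicits.

Lemma cocycle_submod_closed n : submod_closed (cocycle_pred n).
Proof.
split=> [|a f h /eqP df /eqP dh]; first exact/eqP/linear0.
by apply/eqP; rewrite linearP /= df dh scaler0 addr0.
Qed.

HB.instance Definition _ n := GRing.isSubmodClosed.Build R (bcochain n)
  (cocycle_pred n) (cocycle_submod_closed n).

Record bcocycle n := BCocycle {
  bcocycle_val :> bcochain n;
  bcocycle_valP : bcocycle_val \in cocycle_pred n }.

HB.instance Definition _ n := [isSub for @bcocycle_val n].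
HB.instance Definition _ n := [Choice of bcocycle n by <:].
HB.instance Definition _ n := [SubChoice_isSubLmodule of bcocycle n by <:].

Definition is_coboundary n : bcochain n -> Prop :=
  match n with
  | 0 => fun f => f = 0
  | m.+1 => fun f => exists h : bcochain m, f = delta h
  end.

(* Every coboundary is a cocycle, so that the submodule of cocycles below is  *)
(* the whole image of [delta].                                                *)
Lemma delta_delta n (f : bcochain n) : delta (delta f) = 0.
Proof.
apply/val_inj/funext => t /=; rewrite [RHS]/(0 : R) /delta_fun /=.
under eq_bigr do rewrite /delta_fun mulr_sumr.
rewrite pair_big /= (bigID (fun p : 'I_n.+3 * 'I_n.+2 => (p.2 < p.1)%N)) /=.
pose h (p : 'I_n.+3 * 'I_n.+2) := (lift p.1 p.2, inord p.1 : 'I_n.+2).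
pose h' (p : 'I_n.+3 * 'I_n.+2) :=
  (inord p.2 : 'I_n.+3, inord p.1.-1 : 'I_n.+2).
rewrite (reindex_onto h h') => [|[j i] /= ij]; last first.
  have jn := ltn_ord j; have i_n := ltn_ord i.
  by congr pair; apply/val_inj; rewrite /= ?/bump ?inordK //; lia.
rewrite [X in X + _](eq_bigl (fun p : 'I_n.+3 * 'I_n.+2 => ~~ (p.2 < p.1)%N)).
  rewrite -big_split big1 //= => -[j i] /= ij.
  have jn := ltn_ord j; have i_n := ltn_ord i.
  rewrite inordK ?/bump; last by lia.
  have -> : face (inord j) (face (lift j i) t) = face i (face j t).
    apply/ffunP=> k; rewrite !ffunE; congr (t _); apply/val_inj => /=.
    by rewrite /bump inordK; lia.
  have -> : (j <= i)%N by lia.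
  by rewrite add1n exprS; ring.
move=> [j i] /=; have jn := ltn_ord j; have i_n := ltn_ord i.
rewrite xpair_eqE -!val_eqE /= /bump.
case: (leqP j i) => ij /=.
  by rewrite !inordK /=; lia.
rewrite add0n; case: (ltnP (inord j : 'I_n.+2) i) => //= ji.
rewrite inordK; last by lia.
by lia.
Qed.

Definition coboundary_pred n : {pred bcocycle n} :=
  fun z => `[< is_coboundary (bcocycle_val z) >].
Arguments coboundary_pred : clear implicits.

Lemma coboundary_submod_closed n : submod_closed (coboundary_pred n).
Proof.
case: n => [|n]; split=> [|a x y /asboolP xB /asboolP yB];
  apply/asboolP => //=.
- by rewrite [bcocycle_val x]xB [bcocycle_val y]yB scaler0 addr0.
- by exists 0; rewrite linear0.
- have [[f xf] [h yh]] := (xB, yB).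
  by exists (a *: f + h); rewrite linearP /= -xf -yh.
Qed.

HB.instance Definition _ n := GRing.isSubmodClosed.Build R (bcocycle n)
  (coboundary_pred n) (coboundary_submod_closed n).

(* H^n_b(G; R) *)
Definition bcohomology n : Type := Quotient.quot (coboundary_pred n).

HB.instance Definition _ n :
    EqQuotient _ (Quotient.equiv (coboundary_pred n)) (bcohomology n) :=
  EqQuotient.on (bcohomology n).
HB.instance Definition _ n := Choice.on (bcohomology n).
HB.instance Definition _ n := GRing.Zmodule.on (bcohomology n).

Local Open Scope quotient_scope.

Definition bcohomology_scale n (a : R) :=
  lift_op1 (bcohomology n) (fun z => a *: z).

Lemma pi_bcohomology_scale n a :
  {morph \pi_(bcohomology n) : z / a *: z >-> bcohomology_scale a z}.
Proof.
move=> z; unlock bcohomology_scale; apply/eqP.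
by rewrite -Quotient.idealrBE -scalerBr rpredZ // Quotient.idealrBE reprK.
Qed.

Lemma bcohomology_scaleA n a b (c : bcohomology n) :
  bcohomology_scale a (bcohomology_scale b c) = bcohomology_scale (a * b) c.
Proof.
by elim/quotW: c => z; rewrite -!pi_bcohomology_scale scalerA.
Qed.

Lemma bcohomology_scale1 n : left_id 1 (@bcohomology_scale n).
Proof. by elim/quotW=> z; rewrite -pi_bcohomology_scale scale1r. Qed.

Lemma bcohomology_scaleDr n : right_distributive (@bcohomology_scale n) +%R.
Proof.
move=> a; elim/quotW=> y; elim/quotW=> z.
by rewrite -raddfD -!pi_bcohomology_scale scalerDr raddfD.
Qed.

Lemma bcohomology_scaleDl n (c : bcohomology n) :
  {morph (@bcohomology_scale n)^~ c : a b / a + b}.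
Proof.
move=> a b; elim/quotW: c => z.
by rewrite -!pi_bcohomology_scale scalerDl raddfD.
Qed.

HB.instance Definition _ n := GRing.Zmodule_isLmodule.Build R (bcohomology n)
  (@bcohomology_scaleA n) (@bcohomology_scale1 n) (@bcohomology_scaleDr n)
  (@bcohomology_scaleDl n).

(* H^n_b(G; R) is isomorphic to 0 iff its only element is 0. *)
Definition boundedly_acyclic : Prop :=
  forall n : nat, (1 <= n)%N -> forall c : bcohomology n, c = 0.

End BoundedCohomology.

(* Main.v *)
Require Import Defs.
From HB Require Import structures.
From mathcomp Require Import all_boot all_order all_algebra.
From mathcomp Require Import zify ring lra.
From mathcomp Require Import boolp classical_sets functions reals.
From mathcomp Require Import filter topology normedtype.

(** The group is an ascending HNN extension modelled on the stabilizer of a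
    point in Thompson's group V.  It has generators [s], [d], [t]; put
    [B = <s, d, t s t^-1, t d t^-1>].  Two relators say that conjugation by [t]
    maps [B] into itself, and finitely many more say that [s] is an involution
    and that [t B t^-1] commutes with [s t B t^-1 s^-1].

    Applied inside [t B t^-1], inside [t^2 B t^-2] and so on, the last relators
    produce [2^m] pairwise commuting conjugates of [t^m B t^-m], permuted
    cyclically by an element of order [2^m], the odometer
    ([odometer_order], [odometer_comm]).  The kernel [K] of the homomorphism to
    the integers that counts [t] is the ascending union of the groups
    [t^-n B t^n], so every finite subset of [K] has arbitrarily long finite
    cycles of commuting conjugates ([commuting_conjugates_exponent]).

    These cycles force bounded acyclicity ([boundedly_acyclic_criterion]), by a
    finite version of the ergodicity argument for lamplighter groups.  Let [c] be
    a bounded cocycle.  Moving the vertices of a simplex by independent random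
    right translations changes [c] by a coboundary whose primitive is bounded
    uniformly in the law of the translations ([prism_homotopy], [prism_bound]).
    Translate by a product of independent random words placed in the [N]
    commuting conjugates, times a random power of the element that permutes
    these.  As [c] is left invariant, replacing the vertex [1] by a given element
    of [K] has nearly the same effect as changing the word in any one of the [N]
    lamps, and no bounded function of many independent lamps can detect a change
    in a lamp chosen at random ([mixing]).  So the moved cocycle is almost
    constant on [K] ([lamp_mixing]); in the limit along a filter of such
    translations it is constant.  A cocycle that is constant on the simplices of [K] is a bounded
    coboundary, because the quotient by [K] is the integers, an amenable group
    ([acyclic_list_cochain]).

    The group is not amenable since it acts on a set with a piece [X = 0X + 1X]
    that is preserved by [B], whose elements carry [0X] onto [1X], [1X] onto
    [11X] and [11X] onto [10X]; an invariant mean would give all of these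
    measure zero ([Gamma_not_amenable]). *)
Set Implicit Arguments.
Unset Strict Implicit.
Unset Printing Implicit Defensive.

Import Order.TTheory GRing.Theory Num.Theory.
Import numFieldNormedType.Exports.

Local Open Scope ring_scope.

(** * Finitely supported expectations *)

Section Expectation.
Variable R : realFieldType.

(** Linearity is required on all functions, bounded or not.  In effect this means
    laws of finite support, and in exchange no boundedness condition ever has to
    be carried along.  No exchange of two expectations is needed below: iterated
    expectations are always taken in a fixed order. *)
Definition expectation (T : Type) (E : (T -> R) -> R) : Prop :=
  [/\ forall a f h, E (fun x => a * f x + h x) = a * E f + E h,
      forall f, (forall x, 0 <= f x) -> 0 <= E f
    & E (fun=> 1) = 1].

Variables (T : Type) (E : (T -> R) -> R).
Hypothesis hE : expectation E.

Lemma expectD f h : E (fun x => f x + h x) = E f + E h.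
Proof.
have [lin _ _] := hE.
by rewrite -[E f]mul1r -lin; congr E; apply/funext => x; rewrite mul1r.
Qed.

Lemma expect0 : E (fun=> 0) = 0.
Proof.
have := expectD (fun=> 0) (fun=> 0).
rewrite (_ : (fun=> 0 + 0) = (fun=> 0)); last by apply/funext => x; rewrite addr0.
by move/eqP; rewrite -subr_eq0 opprD addNKr oppr_eq0 => /eqP.
Qed.

Lemma expectZ a f : E (fun x => a * f x) = a * E f.
Proof.
have [lin _ _] := hE.
rewrite -[RHS]addr0 -expect0 -lin; congr E; apply/funext => x; by rewrite addr0.
Qed.

Lemma expectN f : E (fun x => - f x) = - E f.
Proof. by rewrite -mulN1r -expectZ; congr E; apply/funext => x; rewrite mulN1r. Qed.

Lemma expectB f h : E (fun x => f x - h x) = E f - E h.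
Proof. by rewrite expectD expectN. Qed.

Lemma expect_cst a : E (fun=> a) = a.
Proof.
have [_ _ E1] := hE; rewrite -[RHS]mulr1 -E1 -expectZ.
by congr E; apply/funext => x; rewrite mulr1.
Qed.

Lemma ler_expect f h : (forall x, f x <= h x) -> E f <= E h.
Proof.
have [_ pos _] := hE => le_fh; rewrite -subr_ge0 -expectB.
by apply: pos => x; rewrite subr_ge0.
Qed.

Lemma ler_norm_expect f h : (forall x, `|f x| <= h x) -> `|E f| <= E h.
Proof.
move=> fh; rewrite ler_norml -expectN; apply/andP; split; apply: ler_expect => x;
by have := fh x; rewrite ler_norml => /andP[].
Qed.

Lemma expect_sum (I : Type) (r : seq I) (F : I -> T -> R) :
  E (fun x => \sum_(i <- r) F i x) = \sum_(i <- r) E (F i).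
Proof.
elim: r => [|i r IH].
  rewrite big_nil -[RHS]expect0; congr E; apply/funext => x; by rewrite big_nil.
rewrite big_cons -IH -expectD; congr E; apply/funext => x; by rewrite big_cons.
Qed.

End Expectation.

(** * Cochains on lists of vertices *)

Section ListCochains.
Variables (R : realFieldType) (G : Type).
Implicit Types (c : seq G -> R) (s : seq G).

(** A function on lists is a family of cochains of all degrees, the empty simplex
    included.  This is the alternating sum over the omitted vertices
    ([list_delta_sum]), unfolded from the first vertex so that identities between
    chain maps can be proved by induction on the list. *)
Fixpoint list_delta c s : R :=
  if s is x :: s' then c s' - list_delta (fun u => c (x :: u)) s' else 0.

Variable M : G -> (G -> R) -> R.

(** [M x] is the law of a random vertex replacing [x]; the entries of the list
    are replaced independently, equal ones included. *)
Fixpoint push c s : R :=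
  if s is x :: s' then M x (fun y => push (fun u => c (y :: u)) s') else c [::].

(** The usual triangulation of the prism between a simplex and its random
    image, again unfolded from the first vertex. *)
Fixpoint prism c s : R :=
  if s is x :: s' then
    M x (fun y => push (fun u => c [:: x, y & u]) s') -
    prism (fun u => c (x :: u)) s'
  else 0.

Lemma list_deltaB c c' s :
  list_delta (fun u => c u - c' u) s = list_delta c s - list_delta c' s.
Proof.
elim: s c c' => [|x s IH] c c' /=; first by rewrite subr0.
by rewrite IH; ring.
Qed.

Hypothesis hM : forall x, expectation (M x).

Lemma pushB c c' s : push (fun u => c u - c' u) s = push c s - push c' s.
Proof.
elim: s c c' => [|x s IH] c c' //=.
by rewrite -expectB //; congr (M x _); apply/funext => y; rewrite IH.
Qed.

Lemma list_delta_expect (T : Type) (E : (T -> R) -> R) (c : T -> seq G -> R) s :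
  expectation E ->
  list_delta (fun u => E (fun x => c x u)) s = E (fun x => list_delta (c x) s).
Proof.
move=> hE; elim: s c => [|x s IH] c /=; first by rewrite expect0.
by rewrite expectB // IH.
Qed.

Lemma list_delta_push c s : list_delta (push c) s = push (list_delta c) s.
Proof.
elim: s c => [|x s IH] c //=.
rewrite list_delta_expect // -[push c s in LHS](expect_cst (hM x)) -expectB //.
by congr (M x _); apply/funext => y; rewrite pushB IH.
Qed.

Lemma prismB c c' s : prism (fun u => c u - c' u) s = prism c s - prism c' s.
Proof.
elim: s c c' => [|x s IH] c c' /=; first by rewrite subr0.
rewrite IH (_ : (fun y => push _ _) = fun y =>
    push (fun u => c [:: x, y & u]) s - push (fun u => c' [:: x, y & u]) s).
  by rewrite expectB //; ring.
by apply/funext => y; rewrite pushB.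
Qed.

(** Pushing along random vertex maps is chain homotopic to the identity.  The
    homotopy grows only with the length of the list ([prism_bound]), whatever the
    laws [M x] are. *)
Lemma prism_homotopy c s :
  list_delta (prism c) s + prism (list_delta c) s = push c s - c s.
Proof.
elim: s c => [|x s IH] c /=; first by rewrite addr0 subrr.
rewrite list_deltaB list_delta_expect //.
have -> : (fun y => push (fun u => c (y :: u) -
      (c (x :: u) - list_delta (fun v => c [:: x, y & v]) u)) s) =
  (fun y => push (fun u => c (y :: u)) s -
      (push (fun u => c (x :: u)) s -
       list_delta (push (fun v => c [:: x, y & v])) s)).
  by apply/funext => y; rewrite !pushB list_delta_push.
rewrite (prismB _ (list_delta (fun u => c (x :: u)))) !expectB // expect_cst //.
have := IH (fun u => c (x :: u)).
set A := list_delta (prism _) s; set B := prism (list_delta _) s => e.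
have -> : B = push (fun u => c (x :: u)) s - c (x :: s) - A by rewrite -e; ring.
ring.
Qed.
End ListCochains.

Section PushBounds.
Variables (R : realFieldType) (G : Type) (M : G -> (G -> R) -> R).
Hypothesis hM : forall x, expectation (M x).

Lemma push_bound C c s : (forall u, `|c u| <= C) -> `|push M c s| <= C.
Proof.
elim: s c => [|x s IH] c cC //=.
rewrite -[C](expect_cst (hM x)); apply: ler_norm_expect => // y; exact: IH.
Qed.

Lemma prism_bound C c s :
  (forall u, `|c u| <= C) -> `|prism M c s| <= (size s)%:R * C.
Proof.
elim: s c => [|x s IH] c cC /=; first by rewrite normr0 mul0r.
rewrite -nat1r mulrDl mul1r (le_trans (ler_normB _ _)) // lerD ?IH //.
rewrite -[leRHS](expect_cst (hM x)); apply: ler_norm_expect => // y.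
exact: push_bound.
Qed.

Variable phi : G -> G.
Hypothesis phiM : forall x f, M (phi x) f = M x (fun y => f (phi y)).

Lemma push_equivariant c s :
  push M c (map phi s) = push M (fun u => c (map phi u)) s.
Proof.
elim: s c => [|x s IH] c //=; rewrite phiM.
by congr (M x _); apply/funext => y; rewrite IH.
Qed.

Lemma prism_equivariant c s :
  prism M c (map phi s) = prism M (fun u => c (map phi u)) s.
Proof.
elim: s c => [|x s IH] c //=; rewrite phiM IH; congr (_ - _).
by congr (M x _); apply/funext => y; rewrite push_equivariant.
Qed.
End PushBounds.

(** * Independent samples *)

Section Iterated.
Variables (R : realFieldType) (I : Type) (E : (I -> R) -> R).
Hypothesis hE : expectation E.

Fixpoint iter_expect n (F : seq I -> R) : R :=
  if n is n'.+1 then E (fun i => iter_expect n' (fun y => F (i :: y))) else F [::].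

Lemma expectation_iter_expect n : expectation (iter_expect n).
Proof.
elim: n => [|n [lin pos one]]; first by split=> // f f0; apply: f0.
have [lin1 pos1 one1] := hE; split => [a f h|f f0|] /=.
- by rewrite -lin1; congr E; apply/funext => i; rewrite lin.
- by apply: pos1 => i; apply: pos => y; apply: f0.
- by rewrite -[RHS]one1; congr E; apply/funext => i; rewrite one.
Qed.

Lemma push_iter_expect (G : Type) (v : G -> I -> G) c s :
  push (fun x f => E (fun i => f (v x i))) c s =
  iter_expect (size s) (fun y => c [seq v p.1 p.2 | p <- zip s y]).
Proof.
elim: s c => [|x s IH] c //=; congr E; apply/funext => i; exact: IH.
Qed.

Lemma iter_expect_map (phi : I -> I) n F :
  (forall f, E (fun i => f (phi i)) = E f) ->
  iter_expect n (fun y => F (map phi y)) = iter_expect n F.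
Proof.
move=> phiE; elim: n F => [|n IH] F //=.
rewrite -(phiE (fun i => iter_expect n (fun y => F (i :: y)))).
by congr E; apply/funext => i; rewrite -(IH (fun y => F (phi i :: y))).
Qed.

Lemma ler_iter_expect n F H : (forall y, size y = n -> F y <= H y) ->
  iter_expect n F <= iter_expect n H.
Proof.
elim: n F H => [|n IH] F H FH /=; first exact: FH.
by apply: ler_expect => // i; apply: IH => y sy; apply: FH; rewrite /= sy.
Qed.

Lemma eq_iter_expect n F H : (forall y, size y = n -> F y = H y) ->
  iter_expect n F = iter_expect n H.
Proof.
move=> FH; apply/eqP; rewrite eq_le; apply/andP.
by split; apply: ler_iter_expect => y sy; rewrite FH.
Qed.

Lemma iter_expect_sum (T : Type) (b : T -> I -> R) (s : seq T) :
  iter_expect (size s) (fun y => \sum_(p <- zip s y) b p.1 p.2) = \sum_(x <- s) E (b x).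
Proof.
elim: s => [|x s IH]; first by rewrite /= !big_nil.
rewrite big_cons -IH /= -[X in _ + X](expect_cst hE) -(expectD hE).
congr E; apply/funext => i.
rewrite -[X in X + _](expect_cst (expectation_iter_expect (size s))).
rewrite -(expectD (expectation_iter_expect _)).
by congr iter_expect; apply/funext => y; rewrite big_cons.
Qed.

Variables (L : Type) (C : L -> I -> I) (rho : L -> I -> R).
Hypothesis rhoE : forall g f, E (fun i => f (C g i)) = E (fun i => rho g i * f i).

(** If applying [C g] to a sample is the same in law as reweighting the sample by
    [rho g], then applying such maps to independent samples amounts to reweighting
    by the product of the densities. *)
Lemma iter_expect_density gs F :
  iter_expect (size gs) (fun y => F [seq C p.1 p.2 | p <- zip gs y]) =
  iter_expect (size gs) (fun y => (\prod_(p <- zip gs y) rho p.1 p.2) * F y).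
Proof.
elim: gs F => [|g gs IH] F /=; first by rewrite big_nil mul1r.
rewrite (rhoE g (fun i => iter_expect (size gs) (fun y =>
  F (i :: [seq C p.1 p.2 | p <- zip gs y])))).
congr E; apply/funext => i; rewrite (IH (fun y => F (i :: y))).
rewrite -(expectZ (expectation_iter_expect _)); congr iter_expect; apply/funext => y.
by rewrite big_cons mulrA.
Qed.
End Iterated.

Section Average.
Variables (R : realFieldType) (I : finType).
Definition avg (f : I -> R) : R := (\sum_i f i) / #|I|%:R.

Lemma expectation_avg (i0 : I) : expectation avg.
Proof.
have I0 : #|I|%:R != 0 :> R by rewrite pnatr_eq0 -lt0n; apply/card_gt0P; exists i0.
split => [a f h|f f0|]; rewrite /avg.
- by rewrite big_split -mulr_sumr mulrDl mulrA.
- by apply: divr_ge0; [apply: sumr_ge0 | apply: ler0n].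
- by rewrite sumr_const divff.
Qed.

Lemma avg_bij (phi : I -> I) f : injective phi -> avg (fun i => f (phi i)) = avg f.
Proof. by move=> phi_inj; rewrite /avg [in RHS](reindex_inj phi_inj). Qed.

Lemma avg_density (C : I -> I) (f : I -> R) :
  avg (fun i => f (C i)) = avg (fun i => #|[pred j | C j == i]|%:R * f i).
Proof.
rewrite /avg; congr (_ / _).
rewrite (partition_big C xpredT) //=; apply: eq_bigr => i _.
rewrite -sum1_card natr_sum mulr_suml; apply: eq_bigr => j /eqP <-.
by rewrite mul1r.
Qed.
End Average.

(** A law of large numbers.  The density [rho l] of the [l]-th perturbation is not
    affected by the other ones, so the deviations [rho l - 1] are orthogonal and
    the mean of the [N] densities has variance at most [D / N].  If all
    perturbations change the expectation of [F] to the same value [u], then [u]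
    is the expectation of [F] weighted by this mean, and Cauchy-Schwarz
    bounds its distance to the unweighted expectation. *)
Lemma mixing (R : realFieldType) (T : Type) (E : (T -> R) -> R) (N : nat)
    (C : 'I_N -> T -> T) (rho : 'I_N -> T -> R) (D B u eps : R) (F : T -> R) :
  expectation E ->
  (forall l f, E (fun x => f (C l x)) = E (fun x => rho l x * f x)) ->
  (forall l m x, l != m -> rho m (C l x) = rho m x) ->
  (forall l x, 0 <= rho l x <= D) ->
  (forall x, `|F x| <= B) ->
  (forall l, E (fun x => F (C l x)) = u) ->
  0 < eps -> (0 < N)%N -> D * (B ^+ 2 + 1) <= N%:R * eps ^+ 2 ->
  `|u - E F| <= eps.
Proof.
move=> hE rhoE rho_indep rho_bd FB Fu eps_gt0 N_gt0 DN.
have NR : 0 < N%:R :> R by rewrite ltr0n.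
pose h x := (\sum_l rho l x) / N%:R - 1.
have E1 l : E (rho l) = 1.
  have := rhoE l (fun=> 1); rewrite expect_cst // => ->.
  by congr E; apply/funext => x; rewrite mulr1.
have Eh : E (fun x => F x * h x) = u - E F.
  have -> : (fun x => F x * h x) =
    (fun x => N%:R^-1 * (\sum_l rho l x * F x) - F x).
    by apply/funext => x; rewrite /h -mulr_suml; ring.
  rewrite expectB // expectZ // expect_sum //; congr (_ - _).
  under eq_bigr do rewrite -rhoE Fu.
  by rewrite sumr_const card_ord -[u *+ N]mulr_natl mulrA mulVf ?mul1r ?gt_eqF.
have Eh2 : E (fun x => h x ^+ 2) <= D / N%:R.
  have -> : (fun x => h x ^+ 2) = (fun x => N%:R^-2 * \sum_l \sum_m
      (rho l x * rho m x - rho l x - rho m x + 1)).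
    apply/funext => x; rewrite /h; pose r := \sum_l rho l x; rewrite -/r.
    rewrite (eq_bigr (fun l => rho l x * (r - N%:R) + (N%:R - r))) => [|l _].
      rewrite big_split -mulr_suml -/r sumr_const card_ord /=.
      by field; rewrite gt_eqF.
    rewrite big_split !sumrB /= -mulr_sumr -/r !sumr_const card_ord.
    by rewrite -[rho l x *+ N]mulr_natl; ring.
  rewrite expectZ // expect_sum //.
  have corr l m : E (fun x => rho l x * rho m x - rho l x - rho m x + 1) <=
     if m == l then D else 0.
    rewrite expectD // !expectB // !E1 expect_cst //.
    have [<-|lm] := eqVneq m l.
      have : E (fun x => rho m x * rho m x) <= E (fun x => D * rho m x).
        apply: ler_expect => // x; have /andP[r0 rD] := rho_bd m x.
        exact: ler_wpM2r.
      by rewrite expectZ // E1; lra.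
    rewrite -(rhoE l (rho m)).
    have -> : (fun x => rho m (C l x)) = rho m.
      by apply/funext => x; rewrite rho_indep // eq_sym.
    by rewrite E1; lra.
  rewrite ler_pdivlMr // mulrC mulrA.
  have -> : N%:R * N%:R^-2 = N%:R^-1 :> R by field; rewrite gt_eqF.
  rewrite mulrC ler_pdivrMr //.
  rewrite (_ : D * N%:R = \sum_(l < N) D); last first.
    by rewrite sumr_const card_ord mulr_natr.
  apply: ler_sum => l _; rewrite expect_sum //.
  apply: le_trans (ler_sum _ (fun m _ => corr l m)) _.
  by rewrite -big_mkcond big_pred1_eq.
rewrite -Eh.
(* Cauchy-Schwarz in the form 2 |F h| <= al F^2 + h^2 / al; this [al] makes both
   terms at most [eps]. *)
pose al := eps / (B ^+ 2 + 1).
have B1 : 0 < B ^+ 2 + 1 by rewrite ltr_wpDl ?sqr_ge0.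
have al_gt0 : 0 < al by rewrite divr_gt0.
apply: (@le_trans _ _ (E (fun x => 2^-1 * (al * B ^+ 2) + (2^-1 * al^-1) * h x ^+ 2))).
  apply: ler_norm_expect => // x.
  have F2 : `|F x| ^+ 2 <= B ^+ 2.
    by rewrite lerXn2r ?nnegrE // (le_trans _ (FB x)).
  apply: (@le_trans _ _ (2^-1 * (al * `|F x| ^+ 2) + 2^-1 * al^-1 * `|h x| ^+ 2)).
    rewrite normrM -subr_ge0.
    have -> : 2^-1 * (al * `|F x| ^+ 2) + 2^-1 / al * `|h x| ^+ 2 - `|F x| * `|h x|
        = (2^-1 * al) * (`|F x| - `|h x| / al) ^+ 2.
      by field; rewrite gt_eqF.
    by rewrite mulr_ge0 ?sqr_ge0 // mulr_ge0 ?invr_ge0 // ltW.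
  rewrite -[`|h x| ^+ 2]normrX (ger0_norm (sqr_ge0 (h x))) lerD2r.
  by rewrite ler_wpM2l ?invr_ge0 // ler_wpM2l // ltW.
rewrite expectD // expect_cst // expectZ //.
have b1 : al * B ^+ 2 <= eps.
  by rewrite /al mulrAC ler_pdivrMr // ler_wpM2l ?ltW //; lra.
have b2 : al^-1 * E (fun x => h x ^+ 2) <= eps.
  apply: (@le_trans _ _ (al^-1 * (D / N%:R))); first by rewrite ler_wpM2l // invr_ge0 ltW.
  rewrite /al invf_div mulrACA -invfM ler_pdivrMr ?mulr_gt0 //.
  rewrite [leLHS]mulrC; apply: le_trans DN _.
  by rewrite (_ : N%:R * _ = eps * (eps * N%:R)) //; ring.
by rewrite -[2^-1 / al * _]mulrA; lra.
Qed.

(** * Lamp configurations *)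

Lemma take_belast (T : Type) (x : T) (s : seq T) k :
  (k < size s)%N -> take k.+1 (belast x s) = x :: take k s.
Proof.
elim: s x k => [|y s IH] x [|k] //= ks; first by rewrite take0.
by rewrite -IH.
Qed.

Section LampGroup.
Variables (G : groupType) (L : finType) (F : L -> G) (a : G) (N' M' : nat).
Local Notation N := N'.+1.
Local Notation M := M'.+1.
Local Open Scope group_scope.
Hypothesis aN : a ^+ N = 1.
Hypothesis comm : forall x y j, (0 < j < N)%N ->
  commute (F x) (a ^+ j * F y * a ^- j).

Definition word_value (u : seq L) : G := foldr (fun x g => F x * g) 1 u.

(** A random word of random length: the letters are stored up to the largest
    length [M], and only an initial segment is read. *)
Definition lamp : finType := ('I_M * M.-tuple L)%type.
Definition lamp_value (s : lamp) : G := word_value (take s.1 s.2).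

(** Prepending a letter does not respect a bound on the length.  Here the length
    wraps around, which gives a map from samples to samples that is wrong with
    probability [1 / M] only ([lamp_value_cons]).  The law of [lamp_cons x s] has
    a density, which may be large; it is enough that it is finite. *)
Definition lamp_cons (x : L) (s : lamp) : lamp :=
  (ordS s.1, [tuple of belast x s.2]).

Lemma lamp_value_cons x s : s.1 != ord_max ->
  lamp_value (lamp_cons x s) = F x * lamp_value s.
Proof.
case: s => k t; rewrite -val_eqE /= => kM.
have kM' : (k.+1 < M)%N by rewrite ltnS ltn_neqAle kM -ltnS ltn_ord.
rewrite /lamp_value /= modn_small // take_belast //.
by rewrite size_tuple (ltnW kM').
Qed.

Definition config : finType := ({ffun 'I_N -> lamp} * 'I_N)%type.
(** For [N] lamps, since [a ^+ N = 1], this is the product of the commuting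
    elements [a ^+ j * x_j * a ^- j], in a form in which the first lamp comes first and
    multiplication by [a] on the left visibly rotates the lamps. *)
Definition lamp_prod (u : seq G) : G := foldr (fun x g => x * (a * g)) 1 u.

(** The final random power of [a] makes the law of this element invariant under
    left multiplication by [a]. *)
Definition config_value (y : config) : G :=
  lamp_prod [seq lamp_value (y.1 j) | j <- enum 'I_N] * a ^+ y.2.
Definition rotate (y : config) : config :=
  ([ffun j => y.1 (ord_pred j)], ordS y.2).
Definition config_cons (l : 'I_N) (x : L) (y : config) : config :=
  ([ffun j => if j == l then lamp_cons x (y.1 j) else y.1 j], y.2).

Lemma lamp_prod_rcons u x : lamp_prod (rcons u x) = lamp_prod u * (x * a).
Proof.
by elim: u => [|y u IH] /=; rewrite ?mulg1 ?mul1g // IH !mulgA.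
Qed.

Lemma word_value_comm z u j : (0 < j < N)%N ->
  (forall x, commute z (a ^+ j * F x * a ^- j)) ->
  commute z (a ^+ j * word_value u * a ^- j).
Proof.
move=> jN zF; elim: u => [|x u IH] /=; first by rewrite mulg1 mulgV; exact: commute1.
have -> : a ^+ j * (F x * word_value u) * a ^- j =
   (a ^+ j * F x * a ^- j) * (a ^+ j * word_value u * a ^- j).
  by rewrite !mulgA mulgVK.
exact: commuteM.
Qed.

Lemma lamp_value_comm s s' j : (0 < j < N)%N ->
  commute (lamp_value s) (a ^+ j * lamp_value s' * a ^- j).
Proof.
move=> jN; apply: word_value_comm => // x; apply: commute_sym.
rewrite /lamp_value; elim: (take _ _) => [|y u IH] /=; first exact: commute1.
by apply: commuteM => //; apply: commute_sym; apply: comm.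
Qed.

Lemma lamp_prod_comm z (u : seq lamp) i : (0 < i)%N -> (i + size u <= N)%N ->
  (forall s j, (0 < j < N)%N -> commute z (a ^+ j * lamp_value s * a ^- j)) ->
  commute z (a ^+ i * lamp_prod (map lamp_value u) * a ^- (i + size u)).
Proof.
move=> + + zc; elim: u i => [|s u IH] i i0 /= iN.
  by rewrite addn0 mulg1 mulgV; exact: commute1.
have -> : a ^+ i * (lamp_value s * (a * lamp_prod (map lamp_value u))) *
    a ^- (i + (size u).+1) =
  (a ^+ i * lamp_value s * a ^- i) *
  (a ^+ i.+1 * lamp_prod (map lamp_value u) * a ^- (i.+1 + size u)).
  by rewrite addnS addSn (expgSr a i) !mulgA mulgVK.
apply: commuteM; last by apply: IH; rewrite ?addSnnS.
by apply: zc; rewrite i0 /= (leq_trans _ iN) // -addSnnS leq_addr.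
Qed.

(** The last lamp commutes with the product of [a] and all the other ones, so it
    can be brought to the front. *)
Lemma lamp_prod_rotate (u : seq lamp) s : size u = N' ->
  a * lamp_prod (map lamp_value (rcons u s)) =
  lamp_prod (map lamp_value (s :: u)) * a.
Proof.
move=> uN; rewrite map_rcons lamp_prod_rcons /=.
have /= := @lamp_prod_comm (lamp_value s) u 1 isT.
rewrite uN addSn add0n aN invg1 mulg1 expg1 => /(_ (leqnn _)) h.
rewrite !mulgA; congr (_ * _); symmetry; rewrite -mulgA; apply: h => s' j jN.
exact: lamp_value_comm.
Qed.

Lemma config_value_rotate y : a * config_value y = config_value (rotate y).
Proof.
rewrite /config_value mulgA.
have -> : a ^+ (rotate y).2 = a * a ^+ y.2.
  have [lt|ge] := ltnP y.2.+1 N; first by rewrite /= modn_small // expgS.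
  have e : (y.2 : nat) = N' by apply/eqP; rewrite eqn_leq -ltnS ltn_ord -ltnS.
  by rewrite /= e modnn -expgS aN.
rewrite mulgA; congr (_ * _).
rewrite (map_comp lamp_value y.1) (map_comp lamp_value (rotate y).1).
have eqm : map y.1 (enum 'I_N) =
    rcons [seq y.1 (widen_ord (leqnSn _) j) | j <- enum 'I_N'] (y.1 ord_max).
  by rewrite enum_ordSr map_rcons -map_comp.
have -> : map (rotate y).1 (enum 'I_N) =
    y.1 ord_max :: [seq y.1 (widen_ord (leqnSn _) j) | j <- enum 'I_N'].
  rewrite enum_ordSl /= ffunE -map_comp; congr cons.
    by congr (y.1 _); apply/val_inj; rewrite /= modn_small.
  apply: eq_map => j /=; rewrite ffunE; congr (y.1 _); apply/val_inj => /=.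
  by rewrite modnDr modn_small // (leq_trans (ltn_ord j)).
by rewrite eqm lamp_prod_rotate // size_map size_enum_ord.
Qed.

Lemma rotate_inj : injective rotate.
Proof.
move=> [y k] [y' k'] [/ffunP yy' kk]; congr pair.
  by apply/ffunP => j; have := yy' (ordS j); rewrite !ffunE ordSK.
by apply: (can_inj (@ordSK _)); apply: val_inj.
Qed.

Lemma rotate_cons l x y :
  rotate (config_cons l x y) = config_cons (ordS l) x (rotate y).
Proof.
congr pair; apply/ffunP => j; rewrite !ffunE /=.
by rewrite -[j == _](can_eq (@ord_predK _)) ordSK.
Qed.

Lemma config_value_cons x (y : config) : (y.1 ord0).1 != ord_max ->
  config_value (config_cons ord0 x y) = F x * config_value y.
Proof.
move=> y0; rewrite /config_value !enum_ordSl /= ffunE eqxx lamp_value_cons //.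
rewrite !mulgA -!map_comp; congr (_ * _ * _ * _ * _); congr lamp_prod.
by apply: eq_map => j /=; rewrite ffunE.
Qed.

(** Hence changes in different lamps are independent in the sense of [mixing]. *)
Lemma config_cons_preim l x (y : config) :
  #|[pred z | config_cons l x z == y]| = #|[pred s | lamp_cons x s == y.1 l]|.
Proof.
pose put s : config := ([ffun j => if j == l then s else y.1 j], y.2).
have put_inj : injective put.
  by move=> s s' [/ffunP/(_ l)]; rewrite !ffunE eqxx.
rewrite -(card_image put_inj); apply: eq_card => z.
apply/idP/idP => [|/fintype.imageP[s]]; rewrite inE => /eqP; last first.
  move=> sy ->; rewrite inE; apply/eqP; case: y @put put_inj sy => y k put _ /= sy.
  congr pair; apply/ffunP => j; rewrite !ffunE; case: eqP => // ->.
  by rewrite ?eqxx.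
move=> e; apply/fintype.imageP; exists (z.1 l); first by rewrite inE -e /= ffunE eqxx.
case: z e => z k e; rewrite /put -e /=; congr pair; apply/ffunP => j; rewrite !ffunE.
by case: eqP => // ->.
Qed.

End LampGroup.

(** The shift permutes the level sets of [h] cyclically, so they have equal mass.
    This gives the probability that a lamp holds a word of maximal length. *)
Lemma avg_cyclic_shift (R : realType) (I : finType) (i0 : I) m (phi : I -> I)
    (h : I -> 'I_m.+1) j :
  injective phi -> (forall i, h (phi i) = ordS (h i)) ->
  avg (fun i => (h i == j)%:R : R) = m.+1%:R^-1.
Proof.
move=> phi_inj hphi; have hE := expectation_avg R i0.
pose p k : R := avg (fun i => (h i == k)%:R : R).
have pS k : p (ordS k) = p k.
  rewrite /p -(avg_bij _ phi_inj); congr avg; apply/funext => i.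
  by rewrite hphi (can_eq (@ordSK _)).
have p0 k : p k = p ord0.
  case: k; elim=> [|k IH] km; first by congr p; apply/val_inj.
  have km' := ltnW km; rewrite -(IH km') -(pS (Ordinal km')).
  by congr p; apply/val_inj; rewrite /= modn_small.
have : \sum_k p k = 1.
  rewrite -expect_sum // -[RHS](expect_cst hE); congr avg; apply/funext => i.
  by rewrite (bigD1 (h i)) //= eqxx big1 ?addr0 // => k /negPf; rewrite eq_sym => ->.
under eq_bigr do rewrite p0.
rewrite sumr_const card_ord -/(p j) (p0 j) => pm.
have m0 : m.+1%:R != 0 :> R by rewrite pnatr_eq0.
by apply: (mulfI m0); rewrite divff // mulr_natl.
Qed.

Definition right_avg (R : realType) (G : groupType) (I : finType) (w : I -> G)
  (x : G) (f : G -> R) : R := avg (fun i => f (x * w i)%g).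

Lemma expectation_right_avg (R : realType) (G : groupType) (I : finType) (i0 : I)
    (w : I -> G) x : expectation (@right_avg R G I w x).
Proof.
have [lin pos one] := expectation_avg R i0; split => [a f h|f f0|] //.
  exact: (lin a (fun i => f (x * w i)%g) (fun i => h (x * w i)%g)).
by apply: pos => i; apply: f0.
Qed.

Section LampMixing.
Variables (R : realType) (G : groupType) (L : finType) (l0 : L) (F : L -> G).
Variables (c : seq G -> R) (B : R).
Hypothesis c_inv : forall g u, c [seq (g * x)%g | x <- u] = c u.
Hypothesis c_bd : forall u, `|c u| <= B.

Lemma zip_mapl (S T U : Type) (f : S -> T) (s : seq S) (t : seq U) :
  zip (map f s) t = [seq (f p.1, p.2) | p <- zip s t].
Proof. by elim: s t => [|x s IH] [|y t] //=; rewrite IH. Qed.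

Lemma zip_mapr (S T U : Type) (f : U -> T) (s : seq S) (t : seq U) :
  zip s (map f t) = [seq (p.1, f p.2) | p <- zip s t].
Proof. by elim: s t => [|x s IH] [|y t] //=; rewrite IH. Qed.

(** The length of the lamp words is chosen first, so that the truncation error of
    [lamp_cons] is at most [eps / 2]; then the number of lamps must be large
    compared with the density of [lamp_cons], for which the number of all lamp
    samples is a crude bound. *)
Lemma lamp_mixing n (eps : R) : 0 < eps ->
  exists N0, forall N' (a : G), (N0 <= N')%N -> (a ^+ N'.+1 = 1)%g ->
    (forall x y j, (0 < j < N'.+1)%N -> commute (F x) (a ^+ j * F y * a ^- j)) ->
  exists (I : finType) (i0 : I) (w : I -> G),
  forall gs : seq L, (size gs <= n)%N ->
    `|push (right_avg w) c (map F gs) -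
      push (right_avg w) c (nseq (size gs) 1%g)| <= eps.
Proof.
move=> eps_gt0.
have B0 : 0 <= B by apply: le_trans (c_bd [::]).
pose M' := Num.bound (4 * B * n%:R / eps).
have hM : 2 * B * n%:R / M'.+1%:R <= eps / 2.
  have h : 4 * B * n%:R / eps < M'%:R.
    by apply: archi_boundP; rewrite divr_ge0 ?mulr_ge0 // ltW.
  rewrite ler_pdivrMr ?ltr0n // mulrAC.
  move: h; rewrite ltr_pdivrMr // => h.
  have : M'%:R * eps <= eps * M'.+1%:R.
    by rewrite mulrC ler_wpM2l ?(ltW eps_gt0) // ler_nat.
  move: h; lra.
pose S := lamp L M'.
pose D : R := #|S|%:R ^+ n.
pose N0 := Num.bound (D * (B ^+ 2 + 1) / (eps / 2) ^+ 2).
have S1 : 1 <= #|S|%:R :> R.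
  by rewrite ler1n; apply/card_gt0P; exists (ord0, [tuple of nseq M'.+1 l0]).
exists N0 => N' a N0N' aN comm.
have e2 : 0 < eps / 2 by rewrite divr_gt0.
have hN : D * (B ^+ 2 + 1) <= N'.+1%:R * (eps / 2) ^+ 2.
  have : D * (B ^+ 2 + 1) / (eps / 2) ^+ 2 < N0%:R.
    apply: archi_boundP; apply: divr_ge0; last exact: sqr_ge0.
    by apply: mulr_ge0; [apply: exprn_ge0 | rewrite addr_ge0 ?sqr_ge0].
  rewrite ltr_pdivrMr ?exprn_gt0 // => /ltW h; apply: le_trans h _.
  by rewrite ler_wpM2r ?sqr_ge0 // ler_nat (leq_trans N0N').
pose I := config L N' M'.
pose i0 : I := ([ffun=> (ord0, [tuple of nseq M'.+1 l0])], ord0).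
pose w : I -> G := @config_value G L F a N' M'.
have hE := expectation_avg R i0.
exists I, i0, w => gs gsn; set p := size gs.
pose E := iter_expect (@avg R I) p.
have hEp : expectation E by apply: expectation_iter_expect.
pose Phi (y : seq I) := c (map w y).
pose C (l : 'I_N'.+1) (y : seq I) := [seq config_cons l q.1 q.2 | q <- zip gs y].
have -> : push (right_avg w) c (nseq p 1%g) = E Phi.
  rewrite /right_avg (push_iter_expect _ (fun x i => (x * w i)%g)) size_nseq.
  apply: eq_iter_expect => // y; rewrite /Phi => <-; congr c.
  by elim: y => [|i y IH] //=; rewrite mul1g IH.
have -> : push (right_avg w) c (map F gs) =
    E (fun y => c [seq (F q.1 * w q.2)%g | q <- zip gs y]).
  rewrite /right_avg (push_iter_expect _ (fun x i => (x * w i)%g)) size_map.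
  by congr iter_expect; apply/funext => y; rewrite zip_mapl -map_comp.
pose bad (x : L) (i : I) : R := ((i.1 ord0).1 == ord_max)%:R.
have Ebad x : avg (bad x) = M'.+1%:R^-1.
  pose phi (i : I) : I :=
    ([ffun j => if j == ord0 then (ordS (i.1 j).1, (i.1 j).2) else i.1 j], i.2).
  apply: (avg_cyclic_shift _ i0 _ (phi := phi)) => [|i].
    move=> [y k] [y' k'] [/ffunP yy' ->]; congr pair; apply/ffunP => j.
    have := yy' j; rewrite !ffunE; case: eqP => // _ /= e.
    have e1 := can_inj (@ordSK _) (congr1 fst e); have e2' := congr1 snd e.
    by rewrite [y j]surjective_pairing [y' j]surjective_pairing; congr pair.
  by rewrite /phi ffunE eqxx.
(* A letter multiplied on the left goes into lamp [ord0], unless its word is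
   already of maximal length. *)
have step1 : `|E (fun y => c [seq (F q.1 * w q.2)%g | q <- zip gs y])
      - E (fun y => Phi (C ord0 y))| <= eps / 2.
  rewrite -expectB //.
  apply: (@le_trans _ _ (E (fun y => (2 * B) * \sum_(q <- zip gs y) bad q.1 q.2))).
    apply: ler_norm_expect => // y.
    have bad0 : 0 <= \sum_(q <- zip gs y) bad q.1 q.2.
      by apply: sumr_ge0 => q _; apply: ler0n.
    have [bd|nbd] := boolP (has (fun q : L * I => (q.2.1 ord0).1 == ord_max) (zip gs y)).
      rewrite (le_trans (ler_normB _ _)) // (@le_trans _ _ (2 * B)) //.
        by rewrite mulr_natl mulr2n lerD // c_bd.
      rewrite ler_peMr ?mulr_ge0 //.
      have /hasP[q qz qb] := bd.
      rewrite (big_rem q) //= /bad qb lerDl.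
      by apply: sumr_ge0 => q' _; apply: ler0n.
    rewrite (_ : c _ - _ = 0) ?normr0 ?mulr_ge0 //.
    apply/eqP; rewrite subr_eq0 /Phi /C -map_comp; apply/eqP; congr c.
    move: nbd; rewrite -all_predC => /allP nbd.
    by apply/eq_in_map => q /nbd /= qb; rewrite /w config_value_cons.
  rewrite expectZ // /E /p (iter_expect_sum hE bad).
  under eq_bigr do rewrite Ebad.
  rewrite big_const_seq count_predT iter_addr_0 -[M'.+1%:R^-1 *+ _]mulr_natl -/p mulrA.
  apply: le_trans hM; rewrite ler_wpM2r ?invr_ge0 ?ler0n //.
  by rewrite ler_wpM2l ?mulr_ge0 // ler_nat.
(* By left invariance [c] may be multiplied by [a], which rotates the lamps
   without changing their law: it does not matter which lamp is changed. *)
have shift l : E (fun y => Phi (C (ordS l) y)) = E (fun y => Phi (C l y)).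
  rewrite -[LHS](iter_expect_map p (fun y => Phi (C (ordS l) y))
    (phi := rotate (M' := M'))).
    congr iter_expect; apply/funext => y.
    rewrite /Phi /C zip_mapr -!map_comp -[in RHS](c_inv a) -map_comp; congr c.
    by apply: eq_map => q /=; rewrite /w config_value_rotate // rotate_cons.
  move=> f; exact: (avg_bij f (@rotate_inj _ _ _)).
have const l : E (fun y => Phi (C l y)) = E (fun y => Phi (C ord0 y)).
  case: l; elim=> [|l IH] lN.
    by rewrite (_ : Ordinal lN = ord0) //; apply/val_inj.
  rewrite -(IH (ltnW lN)) -(shift (Ordinal (ltnW lN))).
  rewrite (_ : Ordinal lN = ordS (Ordinal (ltnW lN))) //.
  by apply/val_inj; rewrite /= modn_small.
pose rho (l : 'I_N'.+1) (y : seq I) : R :=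
  \prod_(q <- zip gs y) #|[pred s | lamp_cons q.1 s == q.2.1 l]|%:R.
have step2 : `|E (fun y => Phi (C ord0 y)) - E Phi| <= eps / 2.
  apply: (mixing (E := E) (C := C) (rho := rho) (D := D) (B := B)) => //.
  - move=> l f.
    apply: (iter_expect_density hE (C := config_cons l)
      (rho := fun x (i : I) => #|[pred s | lamp_cons x s == i.1 l]|%:R)) => x h.
    rewrite avg_density; congr avg; apply/funext => i.
    by rewrite config_cons_preim.
  - move=> l m y lm; rewrite /rho /C.
    elim: (gs) y => [|x s IH] [|i y] //=; rewrite !big_cons IH; congr (_ * _) => /=.
    by rewrite ffunE eq_sym (negPf lm).
  - move=> l y; rewrite /rho; apply/andP; split.
      by apply: prodr_ge0 => q _; apply: ler0n.
    apply: (@le_trans _ _ (#|S|%:R ^+ size (zip gs y))).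
      elim: (zip gs y) => [|q s IH]; first by rewrite big_nil expr0.
      rewrite big_cons exprS ler_pM ?ler0n ?prodr_ge0 //; last first.
        by rewrite ler_nat max_card.
    by rewrite /D ler_weXn2l // size_zip (leq_trans _ gsn) // geq_minl.
  by move=> y; exact: c_bd.
apply: le_trans (ler_distD (E (fun y => Phi (C ord0 y))) _ _) _.
by rewrite [leRHS](splitr eps) lerD.
Qed.
End LampMixing.

(** * Limits along filters *)

Section GenLimit.
Local Open Scope classical_set_scope.
Variables (R : realType) (J : Type) (F : set_system J).

(** A linear extension to all bounded functions of the limit along [F]. *)
Definition generalized_limit (Lm : (J -> R) -> R) : Prop :=
  [/\ forall a f h, bounded_real f -> bounded_real h ->
        Lm (fun j => a * f j + h j) = a * Lm f + Lm h,
      forall f C, bounded_real f -> F [set j | `|f j| <= C] -> `|Lm f| <= C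
    & Lm (fun=> 1) = 1].

(** Bounded functions converge along any ultrafilter finer than [F]. *)
Lemma generalized_limit_exists :
  ProperFilter F -> exists Lm, generalized_limit Lm.
Proof.
move=> PF; have [U [UU FU]] := ultraFilterLemma PF.
have PU : ProperFilter U by apply: ultra_proper.
have cvg_bd (f : J -> R) : bounded_real f -> cvg (f @ U).
  move=> [M fM].
  have fM' : U (f @^-1` `[- M, M]).
    by apply: filterE => j /=; rewrite in_itv /= -ler_norml.
  have [l [_ fl]] := @segment_compact R (- M) M (f @ U) _ fM'.
  apply/cvg_ex; exists l => V Vl.
  have [//|nV] := in_ultra_setVsetC (f @^-1` V) UU.
  by have [x [nVx Vx]] := fl (~` V) V nV Vl.
exists (fun f => lim (f @ U)); split => [a f h bf bh|f C bf FC|].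
- apply/cvg_lim => //; apply: cvgD; last exact: cvg_bd.
  by apply: cvgMr; exact: cvg_bd.
- have bC : \near U, `|f U| <= C by apply: FU.
  rewrite ler_norml; apply/andP; split.
    apply: limr_ge; first exact: cvg_bd.
    by apply: filterS bC => j; rewrite ler_norml => /andP[].
  apply: limr_le; first exact: cvg_bd.
  by apply: filterS bC => j; rewrite ler_norml => /andP[].
- exact: lim_cst.
Qed.

Lemma bounded_real_sub (f h : J -> R) :
  bounded_real f -> bounded_real h -> bounded_real (fun j => f j - h j).
Proof.
move=> [A fA] [B hB]; exists (A + B) => j.
by rewrite (le_trans (ler_normB _ _)) // lerD.
Qed.

Lemma bounded_real_cst (a : R) : bounded_real (fun=> a : R) (T := J).
Proof. by exists `|a|. Qed.

Variable Lm : (J -> R) -> R.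
Hypothesis hL : generalized_limit Lm.

Lemma genlimB f h : bounded_real f -> bounded_real h ->
  Lm (fun j => f j - h j) = Lm f - Lm h.
Proof.
have [lin _ _] := hL => bf bh; rewrite addrC -mulN1r -lin //.
by congr Lm; apply/funext => j; rewrite mulN1r addrC.
Qed.

Lemma genlim_cst a : Lm (fun=> a) = a.
Proof.
have [lin _ one] := hL.
have L0 : Lm (fun=> 0) = 0.
  have := genlimB (bounded_real_cst 0) (bounded_real_cst 0).
  by rewrite !subrr.
rewrite -[RHS]addr0 -[X in _ + X]L0 -[X in X + _]mulr1 -one -lin.
- by congr Lm; apply/funext => j; rewrite mulr1 addr0.
- exact: bounded_real_cst.
- exact: bounded_real_cst.
Qed.

Lemma genlim_bound f C : ProperFilter F -> (forall j, `|f j| <= C) -> `|Lm f| <= C.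
Proof.
have [_ bd _] := hL => FF fC; apply: bd; first by exists C.
by apply: filterE.
Qed.

Lemma genlim_eq f h : bounded_real f -> bounded_real h ->
  (forall eps, 0 < eps -> F [set j | `|f j - h j| <= eps]) -> Lm f = Lm h.
Proof.
have [_ bd _] := hL => bf bh fh; apply/eqP; rewrite -subr_eq0 -normr_le0.
apply/ler_addgt0Pr => e e0; rewrite add0r -genlimB //.
by apply: bd; [exact: bounded_real_sub|exact: fh].
Qed.

Lemma bounded_real_dl (T : Type) (c : J -> seq T -> R) s :
  (forall u, bounded_real (fun j => c j u)) ->
  bounded_real (fun j => list_delta (c j) s).
Proof.
elim: s c => [|x s IH] c bc /=; first exact: bounded_real_cst.
by apply: bounded_real_sub => //; apply: IH => u; apply: bc.
Qed.

Lemma list_delta_genlim (T : Type) (c : J -> seq T -> R) s :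
  (forall u, bounded_real (fun j => c j u)) ->
  list_delta (fun u => Lm (fun j => c j u)) s = Lm (fun j => list_delta (c j) s).
Proof.
elim: s c => [|x s IH] c bc /=; first by rewrite genlim_cst.
rewrite IH ?genlimB //; first by apply: bounded_real_dl => u; apply: bc.
Qed.
End GenLimit.

(** * A criterion for bounded acyclicity *)

Section ListAux.
Variables (R : realType) (G : Type).
Implicit Types (c : seq G -> R).

Lemma list_delta_map (phi : G -> G) c s :
  list_delta (fun u => c (map phi u)) s = list_delta c (map phi s).
Proof.
by elim: s c => [|x s IH] c //=; rewrite (IH (fun u => c (phi x :: u))).
Qed.

(** A cochain that depends on the size only is the restriction of [c] to the
    degenerate simplices at [x]. *)
Lemma list_delta_nseq x c s :
  list_delta (fun u : seq G => c (nseq (size u) x)) s = list_delta c (nseq (size s) x).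
Proof.
by elim: s c => [|y s IH] c //=; rewrite (IH (fun u => c (x :: u))).
Qed.

Lemma expectation_dirac (x : G) : expectation (fun f : G -> R => f x).
Proof. by split => // f f0; apply: f0. Qed.

Lemma push_dirac (r : G -> G) c s : push (fun x f => f (r x)) c s = c (map r s).
Proof. by elim: s c => [|x s IH] c //=; rewrite IH. Qed.
End ListAux.

Section Criterion.
Local Open Scope classical_set_scope.
Variables (R : realType) (G : groupType) (t : G) (e : G -> int).
Hypothesis eM : forall x y, e (x * y)%g = e x + e y.
Hypothesis et : e t = 1.

(** In a lamplighter group over the integers the lamps are moved along an infinite
    line; conjugation by an element of finite order moves them along a cycle,
    which has no ends to take care of. *)
Definition commuting_cyclic_conjugates : Prop :=
  forall (F : seq G) N0, {in F, forall x, e x = 0} ->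
  exists N (a : G), [/\ (N0 <= N)%N, (a ^+ N.+1 = 1)%g
    & {in F &, forall x y j, (0 < j < N.+1)%N ->
        commute x (a ^+ j * y * a ^- j)%g}].

Hypothesis comm : commuting_cyclic_conjugates.

Lemma exponent1 : e 1%g = 0.
Proof. by apply: (addrI (e 1%g)); rewrite addr0 -eM mulg1. Qed.

Lemma exponentV x : e (x^-1)%g = - e x.
Proof. by apply/eqP; rewrite -addr_eq0 -eM mulVg exponent1. Qed.

Definition zpow (z : int) : G :=
  match z with Posz n => t ^+ n | Negz n => t ^- n.+1 end%g.

Lemma exponent_zpow z : e (zpow z) = z.
Proof.
have eX n : e (t ^+ n)%g = n%:Z.
  elim: n => [|n IH]; first by rewrite expg0 exponent1.
  by rewrite expgS eM IH et -intS.
by case: z => n /=; rewrite ?exponentV eX ?NegzE.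
Qed.

(** A retraction onto the kernel of [e].  Multiplying on the right keeps it
    equivariant under left translations by the kernel. *)
Definition retract (x : G) : G := (x * (zpow (e x))^-1)%g.

Lemma exponent_retract x : e (retract x) = 0.
Proof. by rewrite eM exponentV exponent_zpow subrr. Qed.

Lemma retractM k x : e k = 0 -> retract (k * x)%g = (k * retract x)%g.
Proof. by move=> ek; rewrite /retract eM ek add0r mulgA. Qed.

Variables (c : seq G -> R) (B : R).
Hypothesis c_inv : forall g u, c [seq (g * x)%g | x <- u] = c u.
Hypothesis c_bd : forall u, `|c u| <= B.
Hypothesis c_cocycle : list_delta c = fun=> 0.

(** The limit is taken over all equivariant random vertex maps, filtered by how
    nearly constant on the kernel of [e] they make [c].  The maps given by lamps
    enter only through the properness of this filter. *)
Let J := {M : G -> (G -> R) -> R | (forall x, expectation (M x)) /\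
  forall g x f, M (g * x)%g f = M x (fun y => f (g * y)%g)}.
Let K (j : J) : G -> (G -> R) -> R := proj1_sig j.

Let hK (j : J) x : expectation (K j x). Proof. exact: (proj2_sig j).1. Qed.

Let near_constant (F : seq G) n (j : J) : Prop :=
  forall s : seq G, {subset s <= F} -> (size s <= n)%N ->
  `|push (K j) c s - push (K j) c (nseq (size s) 1%g)| <= n.+1%:R^-1.

Let Fil : set_system J := fun A => exists (F : seq G) n,
  {in F, forall x, e x = 0} /\ forall j, near_constant F n j -> A j.

Let Fil_proper : ProperFilter Fil.
Proof.
apply: Build_ProperFilter_ex => [A [F [n [F0 FA]]]|].
  have B1 : 0 < n.+1%:R^-1 :> R by rewrite invr_gt0.
  pose f (i : 'I_(size F).+1) := nth 1%g F i.
  have [N0 mix] := lamp_mixing ord0 f c_inv c_bd n B1.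
  have [|N [a [N0N aN acomm]]] := @comm (1%g :: F) N0.
    by move=> x; rewrite inE => /predU1P[->|/F0//]; exact: exponent1.
  have fin i : f i \in 1%g :: F.
    rewrite /f; have [iF|Fi] := ltnP i (size F).
      by rewrite inE mem_nth ?orbT.
    by rewrite nth_default // mem_head.
  have [|I [i0 [w Iw]]] := mix N a N0N aN.
    by move=> x y j jN; apply: acomm.
  have wJ : (forall x, expectation (@right_avg R G I w x)) /\
      forall g x (h : G -> R),
        right_avg w (g * x)%g h = right_avg w x (fun y => h (g * y)%g).
    split=> [x|g x h]; first exact: expectation_right_avg.
    by rewrite /right_avg; congr avg; apply/funext => i; rewrite mulgA.
  exists (exist _ (right_avg w) wJ); apply: FA => s sF sn.
  have := Iw [seq inord (index x F) | x <- s].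
  rewrite size_map => /(_ sn); rewrite -map_comp.
  suff -> : map (f \o (fun x => inord (index x F))) s = s by [].
  rewrite -[RHS]map_id; apply/eq_in_map => x /sF xF /=.
  by rewrite /f inordK ?nth_index // ltnS ltnW // index_mem.
split.
- by exists [::], 0%N.
- move=> A A' [F [n [F0 FA]]] [F' [n' [F0' FA']]].
  exists (F ++ F'), (maxn n n'); split.
    by move=> x; rewrite mem_cat => /orP[/F0|/F0'].
  have mono n1 n2 : (n1 <= n2)%N -> n2.+1%:R^-1 <= n1.+1%:R^-1 :> R.
    by move=> n12; rewrite lef_pV2 ?posrE // ler_nat.
  move=> j nc; split; [apply: FA | apply: FA'] => s sF sn.
    apply: le_trans (nc s _ (leq_trans sn (leq_maxl _ _))) (mono _ _ (leq_maxl _ _)).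
    by move=> x /sF xF; rewrite mem_cat xF.
  apply: le_trans (nc s _ (leq_trans sn (leq_maxr _ _))) (mono _ _ (leq_maxr _ _)).
  by move=> x /sF xF; rewrite mem_cat xF orbT.
- move=> A A' AA' [F [n [F0 FA]]]; exists F, n; split => // j /FA; exact: AA'.
Qed.

(** Write [c1] for the limit of the pushed cocycles; it differs from [c] by the
    coboundary of [b1].  On the kernel of [e] it agrees with [k], which depends
    only on the size of the list and is the coboundary of [k1].  The difference
    [c2 = c1 - k] vanishes on the kernel, so pushing it along the retraction
    kills it and the prism [b2] is a primitive up to sign, but it is invariant
    under the kernel only.  Averaging over powers of [t] gives the invariant
    primitive [b3]. *)
Lemma acyclic_list_cochain : exists b : seq G -> R,
  [/\ forall g u, b [seq (g * x)%g | x <- u] = b u,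
      exists C : nat -> R, forall u, `|b u| <= C (size u)
    & list_delta b =1 c].
Proof.
have [Lm hL] := generalized_limit_exists R Fil_proper.
have KM j g x f : K j (g * x)%g f = K j x (fun y => f (g * y)%g).
  exact: (proj2_sig j).2.
have c_inv' g : (fun u => c [seq (g * x)%g | x <- u]) = c.
  by apply/funext => u; exact: c_inv.
have push_bd u : bounded_real (fun j => push (K j) c u).
  by exists B => j; apply: push_bound.
have prism_bd u : bounded_real (fun j => prism (K j) c u).
  by exists ((size u)%:R * B) => j; apply: prism_bound.
pose c1 u := Lm (fun j => push (K j) c u).
pose b1 u := Lm (fun j => prism (K j) c u).
(* On cocycles one of the two terms of the homotopy vanishes. *)
have prism0 (M : G -> (G -> R) -> R) u : (forall x, expectation (M x)) ->
    prism M (fun=> 0) u = 0.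
  move=> hM; apply/eqP; rewrite -normr_le0 -[leRHS](mulr0 (size u)%:R).
  by apply: prism_bound => // v; rewrite normr0.
have list_delta_b1 u : list_delta b1 u = c1 u - c u.
  rewrite (list_delta_genlim hL) // -[c u](genlim_cst hL) -(genlimB hL) //.
    2: by exists `|c u|.
  congr Lm; apply/funext => j; rewrite -(prism_homotopy (hK j)) c_cocycle.
  by rewrite prism0 ?addr0.
have list_delta_c1 u : list_delta c1 u = 0.
  rewrite (list_delta_genlim hL) // -[RHS](genlim_cst hL); congr Lm; apply/funext => j.
  rewrite list_delta_push // c_cocycle; apply/eqP; rewrite -normr_le0.
  by apply: push_bound => // v; rewrite normr0.
have c1_inv g u : c1 [seq (g * x)%g | x <- u] = c1 u.
  congr Lm; apply/funext => j; rewrite push_equivariant ?c_inv' //.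
have b1_inv g u : b1 [seq (g * x)%g | x <- u] = b1 u.
  congr Lm; apply/funext => j; rewrite prism_equivariant ?c_inv' //.
have c1_bd u : `|c1 u| <= B.
  by apply: (genlim_bound hL Fil_proper) => j; apply: push_bound.
have b1_bd u : `|b1 u| <= (size u)%:R * B.
  by apply: (genlim_bound hL Fil_proper) => j; apply: prism_bound.
pose k (u : seq G) := c1 (nseq (size u) 1%g).
have c1k u : {in u, forall x, e x = 0} -> c1 u = k u.
  move=> u0; apply: (genlim_eq hL) => // eps eps0.
  pose n := maxn (size u) (Num.bound eps^-1).
  exists u, n; split => // j nc.
  apply: le_trans (nc u _ (leq_maxl _ _)) _ => //.
  rewrite invf_ple ?posrE // (le_trans (ltW (archi_boundP _))) ?invr_ge0 ?(ltW eps0) //.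
  by rewrite ler_nat leqW // leq_maxr.
pose c2 u := c1 u - k u.
pose Mr x (f : G -> R) := f (retract x).
have hMr x : expectation (Mr x) by apply: expectation_dirac.
pose b2 := prism Mr c2.
have list_delta_c2 : list_delta c2 = fun=> 0.
  by apply/funext => u; rewrite list_deltaB list_delta_nseq !list_delta_c1 subrr.
have list_delta_b2 u : list_delta b2 u = - c2 u.
  rewrite -[LHS]addr0 -[X in _ + X](prism0 Mr u hMr) -list_delta_c2 prism_homotopy //.
  rewrite push_dirac {1}/c2 c1k ?subrr ?sub0r // => x /mapP[y _ ->].
  exact: exponent_retract.
have c2_inv g : (fun u => c2 [seq (g * x)%g | x <- u]) = c2.
  by apply/funext => u; rewrite /c2 /k size_map c1_inv.
have b2_inv g u : e g = 0 -> b2 [seq (g * x)%g | x <- u] = b2 u.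
  move=> eg; rewrite /b2 prism_equivariant ?c2_inv //.
  by move=> x f; rewrite /Mr retractM.
have b2_bd u : `|b2 u| <= (size u)%:R * (B + B).
  apply: prism_bound => // v; rewrite (le_trans (ler_normB _ _)) //.
  by rewrite lerD ?c1_bd //; exact: c1_bd.
have [Lt hLt] := generalized_limit_exists R eventually_filter.
pose m n u : R := avg (fun i : 'I_n.+1 => b2 [seq (t ^+ i * x)%g | x <- u]).
have hm n : expectation (@avg R 'I_n.+1) by apply: (expectation_avg R ord0).
have m_le n u : `|m n u| <= (size u)%:R * (B + B).
  rewrite -[leRHS](expect_cst (hm n)); apply: (ler_norm_expect (hm n)) => i.
  by rewrite (le_trans (b2_bd _)) // size_map.
have m_bd u : bounded_real (fun n => m n u) by exists ((size u)%:R * (B + B)).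
pose b3 u := Lt (fun n => m n u).
have list_delta_b3 u : list_delta b3 u = - c2 u.
  rewrite (list_delta_genlim hLt) // -[RHS](genlim_cst hLt); congr Lt; apply/funext => n.
  rewrite (list_delta_expect _ _ (hm n)) -[RHS](expect_cst (hm n)); congr avg.
  apply/funext => i; rewrite list_delta_map list_delta_b2 -[in RHS](c2_inv (t ^+ i)%g).
  by [].
have b3_bd u : `|b3 u| <= (size u)%:R * (B + B).
  exact: (genlim_bound hLt eventually_filter).
have b3_K g u : e g = 0 -> b3 [seq (g * x)%g | x <- u] = b3 u.
  move=> eg; congr Lt; apply/funext => n; congr avg; apply/funext => i.
  rewrite -[RHS](b2_inv (t ^+ i * g * t ^- i)%g); last first.
    by rewrite !eM exponentV eg addr0 subrr.
  by rewrite -!map_comp; congr b2; apply: eq_map => x /=; rewrite !mulgA mulgVK.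
have b3_t u : b3 [seq (t * x)%g | x <- u] = b3 u.
  apply: (genlim_eq hLt) => // eps eps0.
  (* The averages over [0 .. n] at [t u] and at [u] differ by two terms only. *)
  pose D := (size u)%:R * (B + B).
  exists (Num.bound ((D + D) / eps)) => // n /= nD.
  rewrite /m /avg card_ord -mulrBl big_ord_recr big_ord_recl /=.
  pose f i := b2 [seq (t ^+ i * x)%g | x <- u].
  rewrite (eq_bigr (fun i : 'I_n => f i.+1)); last first.
    move=> i _; rewrite -map_comp; congr b2; apply: eq_map => x /=.
    by rewrite expgSr mulgA.
  rewrite (_ : b2 [seq (t ^+ n * x)%g | x <- [seq (t * x)%g | x <- u]] = f n.+1); last first.
    rewrite -map_comp; congr b2; apply: eq_map => x /=.
    by rewrite expgSr mulgA.
  rewrite [X in _ - (_ + X)](eq_bigr (fun i : 'I_n => f i.+1)); last first.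
    by move=> i _.
  rewrite opprD addrACA; set S := \sum_(i < n) _.
  have -> : S - b2 [seq (t ^+ 0 * x)%g | x <- u] + (f n.+1 - S) = f n.+1 - f 0%N.
    by rewrite -/(f 0%N); ring.
  have fD i : `|f i| <= D by rewrite (le_trans (b2_bd _)) // size_map.
  rewrite normrM [`|n.+1%:R^-1|]ger0_norm ?invr_ge0 // ler_pdivrMr ?ltr0n //.
  apply: (@le_trans _ _ (D + D)); first by rewrite (le_trans (ler_normB _ _)) // lerD.
  rewrite mulrC -ler_pdivrMr // (le_trans (ltW (archi_boundP _))) //.
    by rewrite divr_ge0 ?addr_ge0 ?(le_trans _ (fD 0%N)) // ltW.
  by rewrite ler_nat leqW.
have b3_tX n u : b3 [seq (t ^+ n * x)%g | x <- u] = b3 u.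
  elim: n => [|n IH].
    by congr b3; rewrite -[RHS]map_id; apply: eq_map => x; rewrite mul1g.
  rewrite -[RHS]IH -[RHS]b3_t -map_comp; congr b3; apply: eq_map => x /=.
  by rewrite mulgA expgS.
have b3_z z u : b3 [seq (zpow z * x)%g | x <- u] = b3 u.
  case: z => n; first exact: b3_tX.
  rewrite -[LHS](b3_tX n.+1) -map_comp; congr b3; rewrite -[RHS]map_id.
  by apply: eq_map => x /=; rewrite mulVKg.
have b3_inv g u : b3 [seq (g * x)%g | x <- u] = b3 u.
  rewrite -[RHS](b3_z (e g)) -[RHS](b3_K (retract g)); last exact: exponent_retract.
  rewrite -map_comp; congr b3; apply: eq_map => x /=.
  by rewrite mulgA mulgVK.
pose k1 u := k (1%g :: u).
have list_delta_k1 u : list_delta k1 u = k u.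
  have : list_delta k (1%g :: u) = 0 by rewrite list_delta_nseq list_delta_c1.
  by move=> /= /eqP; rewrite subr_eq0 => /eqP.
exists (fun u => k1 u - b3 u - b1 u); split.
- by move=> g u; rewrite b3_inv b1_inv /k1 /k /= size_map.
- exists (fun n => B + n%:R * (B + B) + n%:R * B) => u.
  rewrite (le_trans (ler_normB _ _)) // lerD // (le_trans (ler_normB _ _)) //.
  by rewrite lerD //; exact: c1_bd.
- by move=> u; rewrite !list_deltaB list_delta_k1 list_delta_b3 list_delta_b1 /c2; ring.
Qed.
End Criterion.

Lemma list_delta_sum (R : realType) (T : Type) (f : seq T -> R) s :
  list_delta f s = \sum_(j < size s) (-1) ^+ j * f (take j s ++ drop j.+1 s).
Proof.
elim: s f => [|x s IH] f /=; first by rewrite big_ord0.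
rewrite big_ord_recl /= expr0 mul1r drop0 IH -sumrN; congr (_ + _).
by apply: eq_bigr => j _; rewrite exprS !mulN1r mulNr.
Qed.

Section Transfer.
Variables (R : realType) (G : groupType).

Definition list_of_tuple n (t : gtuple G n) : seq G := [seq t i | i <- enum 'I_n.+1].

Definition tuple_of_list n (s : seq G) : gtuple G n := [ffun i : 'I_n.+1 => nth 1%g s i].

Lemma size_list_of_tuple n (t : gtuple G n) : size (list_of_tuple t) = n.+1.
Proof. by rewrite size_map size_enum_ord. Qed.

Lemma nth_list_of_tuple n (t : gtuple G n) (i : 'I_n.+1) :
  nth 1%g (list_of_tuple t) i = t i.
Proof. by rewrite (nth_map ord0) ?size_enum_ord // nth_ord_enum. Qed.

Lemma list_of_tupleK n : cancel (@list_of_tuple n) (@tuple_of_list n).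
Proof. by move=> t; apply/ffunP => i; rewrite ffunE nth_list_of_tuple. Qed.

Lemma tuple_of_listK n s : size s = n.+1 -> list_of_tuple (tuple_of_list n s) = s.
Proof.
move=> sn; apply: (@eq_from_nth _ 1%g); first by rewrite size_list_of_tuple sn.
move=> i; rewrite size_list_of_tuple => i_n.
by rewrite (nth_list_of_tuple _ (Ordinal i_n)) ffunE.
Qed.

Lemma list_of_face n (j : 'I_n.+2) (t : gtuple G n.+1) :
  list_of_tuple (face j t) = take j (list_of_tuple t) ++ drop j.+1 (list_of_tuple t).
Proof.
have jn : (j < size (list_of_tuple t))%N by rewrite size_list_of_tuple.
apply: (@eq_from_nth _ 1%g).
  rewrite size_cat size_takel ?(ltnW jn) // size_drop !size_list_of_tuple.
  by have := ltn_ord j; lia.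
move=> i; rewrite size_list_of_tuple => i_n.
rewrite (nth_list_of_tuple _ (Ordinal i_n)) ffunE nth_cat size_takel ?(ltnW jn) //.
rewrite -nth_list_of_tuple /= /bump; case: ltnP => ij /=.
  by rewrite nth_take.
by rewrite nth_drop [in RHS]addSn subnKC // add1n.
Qed.

Lemma list_of_diag_act n g (t : gtuple G n) :
  list_of_tuple (diag_act g t) = [seq (g * x)%g | x <- list_of_tuple t].
Proof. by rewrite -[RHS]map_comp; apply: eq_map => i; rewrite ffunE. Qed.

Lemma delta_fun_list n (f : seq G -> R) (t : gtuple G n.+1) :
  delta_fun (fun u : gtuple G n => f (list_of_tuple u) : R^o) t =
  list_delta f (list_of_tuple t).
Proof.
rewrite list_delta_sum size_list_of_tuple /delta_fun; apply: eq_bigr => j _.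
by rewrite list_of_face.
Qed.

(** Extension by zero, so that a cocycle on tuples is a cocycle in all degrees. *)
Definition list_cochain n (c : gtuple G n -> R^o) (s : seq G) : R :=
  if size s == n.+1 then c (tuple_of_list n s) else 0.

Lemma list_cochainE n (c : gtuple G n -> R^o) t : list_cochain c (list_of_tuple t) = c t.
Proof. by rewrite /list_cochain size_list_of_tuple eqxx list_of_tupleK. Qed.

Lemma list_delta_list_cochain n (c : gtuple G n -> R^o) :
  (forall t, delta_fun c t = 0) -> list_delta (list_cochain c) = fun=> 0.
Proof.
move=> dc; apply/funext => s; have [sn|sn] := eqVneq (size s) n.+2.
  rewrite -(tuple_of_listK sn) -delta_fun_list -[RHS](dc (tuple_of_list n.+1 s)).
  by congr delta_fun; apply/funext => t; rewrite list_cochainE.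
rewrite list_delta_sum big1 // => j _; rewrite /list_cochain size_cat size_takel; last first.
  exact: ltnW.
rewrite size_drop (_ : _ == _ = false) ?mulr0 //; apply/negP => /eqP.
by have := ltn_ord j; move/eqP: sn; lia.
Qed.

Variables (t : G) (e : G -> int).
Hypothesis eM : forall x y, e (x * y)%g = e x + e y.
Hypothesis et : e t = 1.
Hypothesis comm : commuting_cyclic_conjugates e.

Local Open Scope quotient_scope.

(** Extended by zero, a cocycle of degree [n] is a cocycle in all degrees at once,
    so [acyclic_list_cochain] applies; only the values of the primitive on lists
    of length [n] are kept. *)
Theorem boundedly_acyclic_criterion : boundedly_acyclic R G.
Proof.
case=> // n _; elim/quotW => z.
have /asboolP[[B zB] z_inv] := bcochain_funP (bcocycle_val z).
have dz u : delta_fun (bcocycle_val z) u = 0.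
  have /eqP := bcocycle_valP z => /(congr1 (@bcochain_fun R G n.+2)).
  by move=> /(congr1 (fun f => f u)).
pose c := list_cochain (bcocycle_val z).
have B0 : 0 <= B by apply: le_trans (zB [ffun=> 1%g]).
have [|||b [b_inv [C bC] bc]] := acyclic_list_cochain eM et comm (c := c) (B := B).
- move=> g u; rewrite /c /list_cochain size_map; case: eqP => // un.
  rewrite -[RHS](z_inv g); congr (bcochain_fun _ _); apply/ffunP => i.
  by rewrite !ffunE (nth_map 1%g) // un.
- by move=> u; rewrite /c /list_cochain; case: ifP => _; rewrite ?normr0.
- exact: list_delta_list_cochain.
have bP : (fun u : gtuple G n => b (list_of_tuple u) : R^o) \in @bcochain_pred R G n.
  apply/asboolP; split.
    by exists (C n.+1) => u; rewrite -(size_list_of_tuple u).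
  by move=> g u; rewrite list_of_diag_act b_inv.
have zb : z \in @coboundary_pred R G n.+1.
  apply/asboolP; exists (BCochain bP); apply/val_inj/funext => u /=.
  by rewrite delta_fun_list bc /c list_cochainE.
apply/eqP; rewrite -(raddf0 (\pi_(bcohomology R G n.+1))).
by rewrite -Quotient.idealrBE subr0.
Qed.
End Transfer.

Local Open Scope nat_scope.

(** * Self-similar groups with commuting conjugates *)

Section SelfSimilar.
Local Open Scope group_scope.
Variables (G : groupType) (s d t : G).

Inductive generated (A : seq G) : G -> Prop :=
| Generated1 : generated A 1
| GeneratedIn x : x \in A -> generated A x
| GeneratedM x y : generated A x -> generated A y -> generated A (x * y)
| GeneratedV x : generated A x -> generated A x^-1.

Definition base_gens : seq G := [:: s; d; s ^ t^-1; d ^ t^-1].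
Local Notation B := (generated base_gens).

Hypothesis ss : s * s = 1.
Hypothesis st : (s ^ t^-1) ^ t^-1 = (s ^ t^-1) ^ d^-1.
Hypothesis dt : (d ^ t^-1) ^ t^-1 = (d ^ t^-1) ^ d^-1.
Hypothesis gens_comm : {in base_gens &, forall x y,
  commute (x ^ t^-1) ((y ^ t^-1) ^ s^-1)}.

Lemma base_shift x : B x -> B (x ^ t^-1).
Proof.
have Bs : B s by apply: GeneratedIn; rewrite !inE eqxx.
have Bd : B d by apply: GeneratedIn; rewrite !inE eqxx orbT.
have Bst : B (s ^ t^-1) by apply: GeneratedIn; rewrite !inE eqxx !orbT.
have Bdt : B (d ^ t^-1) by apply: GeneratedIn; rewrite !inE eqxx !orbT.
have BJ y : B y -> B (y ^ d^-1).
  by move=> By; rewrite conjgE; do ?[apply: GeneratedM | apply: GeneratedV].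
elim=> [|y|y z _ By _ Bz|y _ By].
- by rewrite conj1g; exact: Generated1.
- rewrite !inE => /or4P[] /eqP-> //; first by rewrite st; exact: BJ.
  by rewrite dt; exact: BJ.
- by rewrite conjMg; exact: GeneratedM.
- by rewrite conjVg; exact: GeneratedV.
Qed.

Lemma base_shift_comm x y : B x -> B y ->
  commute (x ^ t^-1) ((y ^ t^-1) ^ s^-1).
Proof.
have commV (u v : G) : commute u v -> commute u^-1 v.
  by move=> uv; apply/commute_sym/commuteV/commute_sym.
have commM (u v w : G) : commute u w -> commute v w -> commute (u * v) w.
  by move=> uw vw; apply/commute_sym/commuteM; apply/commute_sym.
move=> Bx By; elim: Bx => [|u uA|u v _ cu _ cv|u _ cu].
- by rewrite conj1g; apply/commute_sym/commute1.
- elim: By => [|v vA|v w _ cv _ cw|v _ cv].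
  + by rewrite !conj1g; exact: commute1.
  + exact: gens_comm.
  + by rewrite (conjMg v) (conjMg (v ^ t^-1)); exact: commuteM.
  + by rewrite !conjVg; exact: commuteV.
- by rewrite conjMg; exact: commM.
- by rewrite conjVg; exact: commV.
Qed.

(** Viewing conjugation by [t] as an embedding of [B] in one half of itself and
    [s] as the exchange of the two halves, this is the adding machine on [2 ^ m]
    parts: it exchanges the halves and advances recursively in one of them. *)
Fixpoint odometer m : G := if m is m'.+1 then s * odometer m' ^ t^-1 else 1.

Lemma base_odometer m : B (odometer m).
Proof.
elim: m => [|m IH] /=; first exact: Generated1.
apply: GeneratedM; last exact: base_shift.
by apply: GeneratedIn; rewrite !inE eqxx.
Qed.

Lemma baseX x n : B x -> B (x ^+ n).
Proof.
move=> Bx; elim: n => [|n IH]; first exact: Generated1.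
by rewrite expgS; exact: GeneratedM.
Qed.

Lemma base_conj x y : B x -> B y -> B (x ^ y).
Proof.
by move=> Bx By; rewrite conjgE; do ?[apply: GeneratedM | apply: GeneratedV].
Qed.

Lemma base_shiftX m x : B x -> B (x ^ (t ^- m)).
Proof.
move=> Bx; elim: m => [|m IH]; first by rewrite expg0 invg1 conjg1.
by rewrite expgS invgM conjgM; exact: base_shift.
Qed.

Lemma commute_conj (x y z : G) : commute x y -> commute (x ^ z) (y ^ z).
Proof. by move=> xy; rewrite /commute -!conjMg xy. Qed.

(** The square of an odometer is the previous odometer acting in both halves at
    once. *)
Lemma odometer_sqX m j :
  odometer m.+1 ^+ j.*2 =
  ((odometer m ^ t^-1) ^ s^-1) ^+ j * (odometer m ^ t^-1) ^+ j.
Proof.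
have sV : s^-1 = s by apply: mulg1_eq.
rewrite -expgMn; last first.
  by apply/commute_sym/base_shift_comm; exact: base_odometer.
rewrite -mul2n expgnA expg2 /=; congr (_ ^+ j).
by rewrite (conjgE _ s^-1) invgK sV !mulgA.
Qed.

Lemma odometer_order m : odometer m ^+ (2 ^ m) = 1.
Proof.
elim: m => [|m IH]; first exact: expg1.
rewrite expnS mul2n odometer_sqX -!conjXg IH.
by rewrite !conj1g mulg1.
Qed.

(** By induction on [m]: an odd power of the odometer carries one half into the
    other, which commutes with it, and an even power acts inside the half as a
    power of the previous odometer. *)
Lemma odometer_comm m x y j : B x -> B y -> (0 < j < 2 ^ m)%N ->
  commute (x ^ (t ^- m)) ((y ^ (t ^- m)) ^ (odometer m ^- j)).
Proof.
move=> Bx By; elim: m j => [|m IH] j; first by case: j => // -[].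
have even_conj i : (y ^ (t ^- m.+1)) ^ (odometer m.+1 ^- i.*2) =
     ((y ^ (t ^- m)) ^ (odometer m ^- i)) ^ t^-1.
  rewrite odometer_sqX invgM conjgM expgS invgM [y ^ _]conjgM -!conjXg -!conjVg.
  rewrite -conjJg; apply/conjg_fixP/commgP.
  apply: base_shift_comm; last by apply: GeneratedV; apply: baseX; exact: base_odometer.
  apply: base_conj; first exact: base_shiftX.
  by apply: GeneratedV; apply: baseX; exact: base_odometer.
move=> /andP[j0 jm].
have -> : x ^ t ^- m.+1 = (x ^ t ^- m) ^ t^-1 by rewrite expgS invgM conjgM.
rewrite -(odd_double_half j); have [jodd|jeven] := boolP (odd j); last first.
  rewrite add0n even_conj; apply: commute_conj; apply: IH.
  by rewrite expnS mul2n in jm; lia.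
rewrite add1n (expgS (odometer m.+1)) (invgM (odometer m.+1)) (conjgM (y ^ _)) even_conj.
rewrite [odometer m.+1]/= (invgM s) (conjgM _ _ s^-1) -conjVg -conjJg.
apply: base_shift_comm; first exact: base_shiftX.
apply: base_conj; last by apply: GeneratedV; exact: base_odometer.
apply: base_conj; first exact: base_shiftX.
by apply: GeneratedV; apply: baseX; exact: base_odometer.
Qed.

Variable e : G -> int.
Hypothesis eM : forall x y, e (x * y) = (e x + e y)%R.
Hypothesis et : e t = 1%R.
Hypothesis es : e s = 0%R.
Hypothesis ed : e d = 0%R.
Hypothesis gen : forall g, generated [:: s; d; t] g.

Lemma exponent_base x : B x -> e x = 0%R.
Proof.
have e1 := exponent1 eM; have eV := exponentV eM.
have eJ y : e (y ^ t^-1) = e y by rewrite conjgE !eM !eV et; lia.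
elim=> [//|y|y z _ ey _ ez|y _ ey].
- by rewrite !inE => /or4P[] /eqP->; rewrite ?eJ.
- by rewrite eM ey ez.
- by rewrite eV ey.
Qed.

(** Negative powers of [t] move to the left and positive ones to the right, because
    conjugation by [t] preserves [B]. *)
Lemma ascending_normal_form g :
  exists n m b, B b /\ g = t ^- n * b * t ^+ m.
Proof.
suff: forall h, (exists n m b, B b /\ h = t ^- n * b * t ^+ m) ->
   (exists n m b, B b /\ h * g = t ^- n * b * t ^+ m) /\
   (exists n m b, B b /\ h * g^-1 = t ^- n * b * t ^+ m).
  move=> /(_ 1)[|[n [m [b [Bb]]]]].
    by exists 0%N, 0%N, 1; rewrite expg0 invg1 !mulg1; split => //; exact: Generated1.
  by rewrite mul1g => gE _; exists n, m, b.
elim: (gen g) => [|x xA|x y _ IHx _ IHy|x _ IHx] h hE.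
- by rewrite invg1 mulg1; split.
- have [n [m [b [Bb ->]]]] := hE.
  have baseR z : B z -> exists n' m' b', B b' /\
      t ^- n * b * t ^+ m * z = t ^- n' * b' * t ^+ m'.
    move=> Bz; exists n, m, (b * z ^ (t ^- m)); split.
      by apply: GeneratedM => //; exact: base_shiftX.
    by rewrite conjgE invgK !mulgA mulgVK.
  move: xA; rewrite !inE => /or3P[] /eqP->.
  + have Bs : B s by apply: GeneratedIn; rewrite !inE eqxx.
    by split; apply: baseR => //; exact: GeneratedV.
  + have Bd : B d by apply: GeneratedIn; rewrite !inE eqxx orbT.
    by split; apply: baseR => //; exact: GeneratedV.
  + split; first by exists n, m.+1, b; rewrite expgSr !mulgA.
    case: m {baseR hE} => [|m]; last by exists n, m, b; rewrite expgSr !mulgA mulgK.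
    exists n.+1, 0%N, (b ^ t^-1); split; first exact: base_shift.
    by rewrite expg0 !mulg1 conjgE invgK expgS invgM !mulgA mulgVK.
- have [hx hx'] := IHx _ hE; have [hy hy'] := IHy _ hE.
  split; first by rewrite mulgA; exact: (IHy _ hx).1.
  by rewrite invgM mulgA; exact: (IHx _ hy').2.
- by rewrite invgK; have [] := IHx _ hE; split.
Qed.

Lemma commuting_conjugates_exponent : commuting_cyclic_conjugates e.
Proof.
move=> F m F0.
have [n Fn] : exists n, {in F, forall x, B (x ^ (t ^- n))}.
  elim: F F0 => [|x F IH] F0; first by exists 0%N.
  have [|n Fn] := IH; first by move=> y yF; apply: F0; rewrite inE yF orbT.
  have [k [l [b [Bb xE]]]] := ascending_normal_form x.
  have eX i : e (t ^+ i) = Posz i by exact: (exponent_zpow eM et (Posz i)).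
  have kl : l = k.
    have := F0 x (mem_head _ _); rewrite xE !eM (exponentV eM) !eX (exponent_base Bb).
    by lia.
  have xk : x ^ (t ^- k) = b.
    by rewrite xE kl conjgE invgK !mulgA mulgV mul1g mulgK.
  exists (n + k)%N => y; rewrite inE => /predU1P[->|yF].
    by rewrite expgnDr invgM conjgM xk; exact: base_shiftX.
  by rewrite addnC expgnDr invgM conjgM; exact/base_shiftX/Fn.
exists (2 ^ m).-1, (odometer m ^ (t ^+ (n + m))); split.
- by rewrite -ltnS prednK ?expn_gt0 // ltn_expl.
- by rewrite prednK ?expn_gt0 // -conjXg odometer_order conj1g.
move=> x y xF yF j; rewrite prednK ?expn_gt0 // => jm.
have back z : ((z ^ (t ^- n)) ^ (t ^- m)) ^ (t ^+ (n + m)) = z.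
  by rewrite -!conjgM addnC expgnDr !mulgA mulgVK mulVg conjg1.
have := commute_conj (t ^+ (n + m)) (odometer_comm (Fn _ xF) (Fn _ yF) jm).
rewrite (conjJg _ (odometer m ^- j)) !back conjVg conjXg conjgE invgK mulgA; exact.
Qed.
End SelfSimilar.

(** * The group and its presentation *)

Section WordAction.
Variables (n : nat) (rels : seq (word n)) (X : Type).
Variable act : letter n -> X -> X.

Definition act_word (w : word n) (x : X) : X := foldr act x w.

Hypothesis actV : forall a x, act a (act (inv_letter a) x) = x.
Hypothesis act_rel : {in rels, forall r x, act_word r x = x}.

Lemma act_word_cat v w x : act_word (v ++ w) x = act_word v (act_word w x).
Proof. exact: foldr_cat. Qed.

Lemma act_word_cong v w : word_cong rels v w -> act_word v =1 act_word w.
Proof.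
elim=> {v w} [w|v w _ vw|u v w _ uv _ vw|v v' w w' _ vv' _ ww'|a|r rR] x //.
- by rewrite uv vw.
- by rewrite !act_word_cat vv' ww'.
- exact: actV.
- exact: act_rel.
Qed.

Local Open Scope quotient_scope.

Definition pres_act (g : presented_group rels) : X -> X := act_word (repr g).

Lemma pres_act_pi w : pres_act (\pi_(presented_group rels) w) =1 act_word w.
Proof. by apply: act_word_cong; apply: repr_cong. Qed.

Lemma pres_actM g h x : pres_act (g * h)%g x = pres_act g (pres_act h x).
Proof.
have -> : (g * h)%g = \pi_(presented_group rels) (repr g ++ repr h).
  by rewrite pi_pres_mul !reprK.
by rewrite pres_act_pi act_word_cat.
Qed.
End WordAction.

Section Group.
Definition word_s : word 3 := [:: (Ordinal (isT : (0 < 3)%N), true)].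
Definition word_d : word 3 := [:: (Ordinal (isT : (1 < 3)%N), true)].
Definition word_t : word 3 := [:: (Ordinal (isT : (2 < 3)%N), true)].
Definition word_conj (g w : word 3) : word 3 := g ++ w ++ inv_word g.
Definition word_comm (v w : word 3) : word 3 := v ++ w ++ inv_word v ++ inv_word w.
Definition word_base_gens : seq (word 3) :=
  [:: word_s; word_d; word_conj word_t word_s; word_conj word_t word_d].

(** In order: [s] is an involution, [t^2 s t^-2] and [t^2 d t^-2] belong to [B] as
    the conjugates by [d] of [t s t^-1] and [t d t^-1], and [t B t^-1] commutes
    with its conjugate by [s]. *)
Definition self_similar_rels : seq (word 3) :=
  [:: word_s ++ word_s
    ; word_conj word_t (word_conj word_t word_s) ++
      inv_word (word_conj word_d (word_conj word_t word_s))
    ; word_conj word_t (word_conj word_t word_d) ++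
      inv_word (word_conj word_d (word_conj word_t word_d))]
  ++ [seq word_comm (word_conj word_t v) (word_conj word_s (word_conj word_t w))
     | v <- word_base_gens, w <- word_base_gens].

Definition Gamma : groupType := presented_group self_similar_rels.

Local Open Scope quotient_scope.
Local Open Scope group_scope.

Definition Pi (w : word 3) : Gamma := \pi_(presented_group self_similar_rels) w.

Lemma PiM v w : Pi (v ++ w) = Pi v * Pi w. Proof. exact: pi_pres_mul. Qed.
Lemma PiV w : Pi (inv_word w) = (Pi w)^-1. Proof. exact: pi_pres_inv. Qed.
Lemma Pi1 : Pi [::] = 1.
Proof. by rewrite -[RHS]/(pres_one _) piE. Qed.

Lemma Pi_rel w : w \in self_similar_rels -> Pi w = 1.
Proof. by move=> wR; rewrite -Pi1; apply/pres_eqP/WordRel. Qed.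

Lemma Pi_conj g w : Pi (word_conj g w) = Pi w ^ (Pi g)^-1.
Proof. by rewrite !PiM PiV conjgE invgK mulgA. Qed.

Lemma Pi_comm v w : Pi (word_comm v w) = 1 -> commute (Pi v) (Pi w).
Proof.
by rewrite !PiM !PiV => vw; apply: divg1_eq; rewrite invgM -vw !mulgA.
Qed.

Local Notation s := (Pi word_s).
Local Notation d := (Pi word_d).
Local Notation t := (Pi word_t).

Lemma Gamma_ss : s * s = 1.
Proof. by rewrite -PiM Pi_rel // mem_head. Qed.

Lemma Gamma_st : (s ^ t^-1) ^ t^-1 = (s ^ t^-1) ^ d^-1.
Proof.
apply: divg1_eq; rewrite -!Pi_conj -PiV -PiM; apply: Pi_rel.
by rewrite !inE eqxx orbT.
Qed.

Lemma Gamma_dt : (d ^ t^-1) ^ t^-1 = (d ^ t^-1) ^ d^-1.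
Proof.
apply: divg1_eq; rewrite -!Pi_conj -PiV -PiM; apply: Pi_rel.
by rewrite !inE eqxx !orbT.
Qed.

Lemma Gamma_comm : {in base_gens s d t &, forall x y,
  commute (x ^ t^-1) ((y ^ t^-1) ^ s^-1)}.
Proof.
have -> : base_gens s d t = map Pi word_base_gens by rewrite /= !Pi_conj.
move=> _ _ /mapP[v vB ->] /mapP[w wB ->]; rewrite -!Pi_conj.
apply: Pi_comm; apply: Pi_rel; rewrite mem_cat; apply/orP; right.
exact: (allpairs_f (fun v w =>
  word_comm (word_conj word_t v) (word_conj word_s (word_conj word_t w)))).
Qed.

Lemma Gamma_gen g : generated [:: s; d; t] g.
Proof.
rewrite -[g]reprK -/(Pi _); elim: (repr g) => [|[i b] w IH].
  by rewrite Pi1; exact: Generated1.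
rewrite -(cat1s (i, b) w) PiM; apply: GeneratedM => //.
suff h : generated [:: s; d; t] (Pi [:: (i, true)]).
  case: b => //; rewrite (_ : [:: (i, false)] = inv_word [:: (i, true)]) // PiV.
  exact: GeneratedV.
apply: GeneratedIn.
have [->|->|->] : [\/ i = Ordinal (isT : (0 < 3)%N), i = Ordinal (isT : (1 < 3)%N)
    | i = Ordinal (isT : (2 < 3)%N)].
- case: i => [[|[|[|//]]]] ?; [constructor 1|constructor 2|constructor 3];
    exact: val_inj.
- by rewrite !inE eqxx.
- by rewrite !inE eqxx orbT.
- by rewrite !inE eqxx !orbT.
Qed.

Definition letter_exponent (a : letter 3) : int :=
  if val a.1 == 2 then (if a.2 then 1 else -1)%R else 0%R.

Definition word_exponent (w : word 3) : int :=
  foldr (fun a z => letter_exponent a + z)%R 0%R w.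

Lemma letter_exponentV a : letter_exponent (inv_letter a) = (- letter_exponent a)%R.
Proof.
by case: a => i []; rewrite /letter_exponent /=; case: ifP => //; rewrite ?oppr0.
Qed.

Let add_exponent (a : letter 3) z : int := (letter_exponent a + z)%R.

Let add_exponentV a z : add_exponent a (add_exponent (inv_letter a) z) = z.
Proof. by rewrite /add_exponent letter_exponentV addrA subrr add0r. Qed.

Let add_exponent_rel :
  {in self_similar_rels, forall r z, act_word add_exponent r z = z}.
Proof.
have rels0 : all (fun r => word_exponent r == 0%R) self_similar_rels.
  by vm_compute.
move=> r /(allP rels0) /eqP r0 z.
suff -> : act_word add_exponent r z = (word_exponent r + z)%R by rewrite r0 add0r.
by elim: (r) => [|a w IH] /=; rewrite ?add0r // IH /add_exponent addrA.
Qed.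

Definition Gamma_exponent (g : Gamma) : int := pres_act add_exponent g 0%R.

Let Gamma_exponent_pi w : Gamma_exponent (Pi w) = word_exponent w.
Proof. by rewrite /Gamma_exponent (pres_act_pi add_exponentV). Qed.

Lemma Gamma_exponentM g h :
  Gamma_exponent (g * h) = (Gamma_exponent g + Gamma_exponent h)%R.
Proof.
rewrite /Gamma_exponent pres_actM //; move: (pres_act _ h _) => z.
rewrite /pres_act; elim: (repr g) => [|a w IH] /=; rewrite ?add0r //.
by rewrite IH /add_exponent addrA.
Qed.

Lemma Gamma_boundedly_acyclic (R : realType) : boundedly_acyclic R Gamma.
Proof.
have et : Gamma_exponent t = 1%R by rewrite Gamma_exponent_pi.
have es : Gamma_exponent s = 0%R by rewrite Gamma_exponent_pi.
have ed : Gamma_exponent d = 0%R by rewrite Gamma_exponent_pi.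
apply: (boundedly_acyclic_criterion Gamma_exponentM et).
exact: (commuting_conjugates_exponent Gamma_ss Gamma_st Gamma_dt Gamma_comm
  Gamma_exponentM et es ed Gamma_gen).
Qed.

End Group.

(** * An action without invariant means *)

Section PointAction.
Definition stream := nat -> bool.
Definition scons (b : bool) (x : stream) : stream :=
  fun n => if n is n'.+1 then x n' else b.
Definition stail (x : stream) : stream := fun n => x n.+1.

Lemma streamE x : x = scons (x 0) (stail x).
Proof. by apply/funext => -[]. Qed.

Definition flip_head (x : stream) : stream := scons (~~ x 0) (stail x).
(** [1w -> 11w], [01w -> 10w], [00w -> 0w]. *)
Definition dilate (x : stream) : stream :=
  if x 0 then scons true x
  else if x 1 then scons true (scons false (stail (stail x))) else stail x.
Definition contract (x : stream) : stream :=
  if x 0 then (if x 1 then stail x else scons false (scons true (stail (stail x))))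
  else scons false x.

(** The ground level is the Cantor space on which [B] acts.  The generator [t] must
    map it into its half [1X] and still be a bijection; the higher levels provide
    the points that fill the other half [0X]. *)
Definition point : Type := (nat * stream)%type.

Definition at_ground (f : stream -> stream) (p : point) : point :=
  if p.1 is 0 then (0, f p.2) else p.

Definition descend (p : point) : point :=
  match p.1 with
  | 0 => (0, scons true p.2) | 1 => (0, scons false p.2) | k.+2 => (k.+1, p.2)
  end.
Definition ascend (p : point) : point :=
  if p.1 is k.+1 then (k.+2, p.2) else (if p.2 0 then 0 else 1, stail p.2).

Definition point_act (a : letter 3) : point -> point :=
  match val a.1, a.2 with
  | 0, _ => at_ground flip_head
  | 1, true => at_ground dilate
  | 1, false => at_ground contract
  | _, true => descend
  | _, false => ascend
  end.

Ltac peel x := rewrite (streamE x); move: (x 0) (stail x) => [] {}x.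

Lemma point_actV a p : point_act a (point_act (inv_letter a) p) = p.
Proof.
case: a => [[[|[|[|//]]] i3] []] /=; case: p => [[|[|k]] x] //;
  by peel x; peel x.
Qed.

Lemma point_act_rel : {in self_similar_rels, forall r p, act_word point_act r p = p}.
Proof.
suff h p : foldr (fun r P => act_word point_act r p = p /\ P) True self_similar_rels.
  move=> r rR p; elim: self_similar_rels (h p) rR => [|r' R IH] //= [r'p Rp].
  by rewrite inE => /predU1P[->|/(IH Rp)].
(* No relator reads more than [5 - k] letters of a point of level [k <= 3], nor
   any letter of a higher point. *)
case: p => [[|[|[|[|k]]]] x]; [do 5 peel x | do 4 peel x | do 3 peel x | do 2 peel x | ];
  by vm_compute; do ?split.
Qed.

Definition ground (p : point) : Prop := p.1 = 0.

Lemma dilate_heads x : dilate x 0 && dilate x 1 = x 0.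
Proof. by peel x; peel x. Qed.

Lemma ground_at_ground f p : ground (at_ground f p) <-> ground p.
Proof. by case: p => [[|k] x]. Qed.

Local Open Scope group_scope.

Let move (g : Gamma) : point -> point := pres_act point_act g.

Let moveM g h p : move (g * h) p = move g (move h p).
Proof. exact: (pres_actM point_actV point_act_rel). Qed.

Let move_pi w p : move (Pi w) p = act_word point_act w p.
Proof. exact: (pres_act_pi point_actV point_act_rel). Qed.

Let swap1 := word_conj word_t word_s.

Let swap1_ground p : ground (move (Pi swap1) p) <-> ground p.
Proof. by rewrite move_pi; case: p => [[|k] x]; first peel x. Qed.

Let swap1_heads x : let y := (move (Pi swap1) (0%N, x)).2 in
  y 0%N && y 1%N = x 0%N && ~~ x 1%N.
Proof. by rewrite move_pi; peel x; peel x. Qed.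

(** A map from the group to the Cantor space, equivariant under the elements that
    preserve the ground level.  The invariant means of the action itself are
    useless, as [t] can push them off to infinity.  Instead [g] is sent to the image
    under [g] of a point chosen in the preimage of the ground level, and this
    preimage does not change when [g] is multiplied on the left by an element
    that preserves the ground level. *)
Lemma base_point_exists : exists f : Gamma -> stream,
  forall g w, (forall p, ground (move (Pi w) p) <-> ground p) ->
    f (Pi w * g) = (move (Pi w) (0%N, f g)).2.
Proof.
have pick (A : set point) : exists p, (A !=set0)%classic -> A p.
  have [[p Ap]|A0] := pselect (A !=set0)%classic; first by exists p.
  by exists (0%N, fun=> true) => /A0.
have [c cP] := choice pick.
pose A g : set point := fun p => ground (move g p).
have cA g : ground (move g (c (A g))).
  apply: (cP (A g)); exists (move g^-1 (0%N, fun=> true)).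
  by rewrite /A -moveM mulgV -Pi1 move_pi.
exists (fun g => (move g (c (A g))).2) => g w wground.
have -> : A (Pi w * g) = A g.
  by apply/funext => p; apply/propext; rewrite /A moveM.
rewrite moveM; congr ((move (Pi w) _).2).
by have := cA g; case: (move g _) => k x; rewrite /ground /= => ->.
Qed.

(** The half [1X] is mapped onto the quarter [11X] by [d], and [11X] onto [10X] by
    [t s t^-1], so its measure is twice itself; [s] maps it onto [0X]. *)
Lemma Gamma_not_amenable (R : realType) : ~ amenable R Gamma.
Proof.
move=> [m [lin pos m1 inv]].
have [f fM] := base_point_exists.
pose chi (a : stream -> bool) (g : Gamma) : R := (a (f g))%:R%R.
have chi_bd a : bounded_real (chi a).
  by exists 1%R => g; rewrite /chi; case: (a _); rewrite ?normr1 ?normr0.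
have chi_move w a b : (forall p, ground (move (Pi w) p) <-> ground p) ->
    (forall x, a (move (Pi w) (0%N, x)).2 = b x) -> m (chi a) = m (chi b).
  move=> wg ab; rewrite -[LHS](inv (Pi w)) //; congr m; apply/funext => g.
  by rewrite /chi fM // ab.
have chiD a b : (forall x, ~~ (a x && b x)) ->
    m (chi (fun x => a x || b x)) = (m (chi a) + m (chi b))%R.
  move=> ab; rewrite -[m (chi a)]mul1r -lin //; congr m; apply/funext => g.
  rewrite mul1r /chi; have := ab (f g).
  by case: (a _); case: (b _) => //= _; rewrite ?addr0 ?add0r.
pose c1 (x : stream) := x 0%N.
have e11 : m (chi (fun x => x 0%N && x 1%N)) = m (chi c1).
  apply: (chi_move word_d) => [p|x]; rewrite move_pi; first exact: ground_at_ground.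
  exact: dilate_heads.
have e10 : m (chi (fun x => x 0%N && x 1%N)) = m (chi (fun x => x 0%N && ~~ x 1%N)).
  by apply: (chi_move swap1) => [p|x]; [exact: swap1_ground|exact: swap1_heads].
have e0 : m (chi c1) = m (chi (fun x => ~~ x 0%N)).
  apply: (chi_move word_s) => [p|x]; rewrite move_pi; first exact: ground_at_ground.
  by [].
have split1 : m (chi c1) = (m (chi c1) + m (chi c1))%R.
  rewrite -[X in (X + _)%R]e11 -[X in (_ + X)%R]e11 [X in (_ + X)%R]e10 -chiD.
    by congr m; apply/funext => g; rewrite /chi /c1; case: (f g 0%N); case: (f g 1%N).
  by move=> x; case: (x 0%N); case: (x 1%N).
have c10 : m (chi c1) = 0%R by apply: (addrI (m (chi c1))); rewrite addr0.
have : m (fun=> 1%R) = (m (chi c1) + m (chi (fun x => ~~ x 0%N)))%R.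
  rewrite -chiD => [|x]; last by rewrite /c1; case: (x 0%N).
  by congr m; apply/funext => g; rewrite /chi /c1; case: (f g 0%N).
by move/eqP; rewrite m1 -e0 c10 addr0 oner_eq0.
Qed.
End PointAction.

Lemma Gamma_finitely_presented : finitely_presented Gamma.
Proof. by exists 3, self_similar_rels, idfun, idfun. Qed.

Theorem theorem4 (R : realType) :
  exists G : groupType,
    [/\ finitely_presented G, ~ amenable R G & boundedly_acyclic R G].
Proof.
exists Gamma; split.
- exact: Gamma_finitely_presented.
- exact: Gamma_not_amenable.
- exact: Gamma_boundedly_acyclic.
Qed.
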